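(* Let $T$ be NIP with monster model $\mathbb{M}$, and let $f: \mathbb{M}^x \to \mathbb{M}^y$ be an $A$-definable function. Then $[\mu] \in \widetilde{\mathcal{M}}_x \mapsto [f_{*} \mu] \in \widetilde{\mathcal{M}}_y$ is an $A$-type-definable function.
   Context: $\mathfrak{M}_x(\mathbb{M})$ is the set of global Keisler measures in $x$ (finitely additive probability measures on definable-with-parameters subsets of $\mathbb{M}^x$). In an NIP theory, $\mu$ is generically stable if for some small model $M$ it is definable over $M$ ($M$-invariant with $\mathrm{tp}(b/M)\mapsto\mu(\varphi(x,b))$ continuous on $S_y(M)$ for all $\varphi$) and finitely satisfiable in $M$ (every formula of positive measure is realized in $M$). The push-forward $f_*\mu\in\mathfrak{M}_y(\mathbb{M})$ is $f_*\mu(\varphi(y)):=\mu(\varphi(f(x)))$; it is generically stable if $\mu$ is. Coding of generically stable measures. For $\bar{a}=(a_1,\dots,a_n)$, $\mathrm{Av}(\bar{a};\varphi(x,b)):=\frac1n|\{i:\models\varphi(a_i,b)\}|$. By NIP there are numbers $n_{\varphi,\varepsilon}$, for $\varphi(x,y)\in L$ and $\varepsilon>0$, so that every generically stable $\mu$ has an $\varepsilon$-approximation on $\varphi$ (i.e. $\bar{a}$ with $|\mathrm{Av}(\bar{a};\varphi(x,b))-\mu(\varphi(x,b))|\le\varepsilon$ for all $b$) of length exactly $n_{\varphi,\varepsilon}$; fix these. For each tuple of variables $x$, let $X_x$ be the $\emptyset$-type-definable set of tuples $\bar{a}=(\bar{a}_{\varphi,1/k}:\varphi(x,y)\in L,k\ge1)$,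 $\bar{a}_{\varphi,1/k}\in(\mathbb{M}^x)^{n_{\varphi,1/k}}$, such that (i) $|\mathrm{Av}(\bar{a}_{\varphi,1/k_1};\varphi(x,b))-\mathrm{Av}(\bar{a}_{\varphi,1/k_2};\varphi(x,b))|\le2/k$ for all $\varphi$, $k$, $k_1,k_2\ge k$ and $b$; and (ii) for all $\varphi_1,\varphi_2,k,b_1,b_2$ with $\varphi_1(x,b_1)\wedge\varphi_2(x,b_2)$ inconsistent, $\mathrm{Av}(\bar{a}_{\varphi_1\vee\varphi_2,1/k};\varphi_1(x,b_1)\vee\varphi_2(x,b_2))$ differs from $\mathrm{Av}(\bar{a}_{\varphi_1,1/k};\varphi_1(x,b_1))+\mathrm{Av}(\bar{a}_{\varphi_2,1/k};\varphi_2(x,b_2))$ by at most $3/k$. For $\bar{a}\in X_x$, $\mu_{\bar{a}}(\varphi(x,b)):=\lim_k\mathrm{Av}(\bar{a}_{\varphi,1/k};\varphi(x,b))$ is a generically stable measure. $E_x(\bar{a},\bar{a}')$ holds iff $|\mathrm{Av}(\bar{a}_{\varphi,1/k};\varphi(x,b))-\mathrm{Av}(\bar{a}'_{\varphi,1/k};\varphi(x,b))|\le4/k$ for all $\varphi,k,b$; on $X_x$ this is a type-definable equivalence relation, holding iff $\mu_{\bar{a}}=\mu_{\bar{a}'}$. $\widetilde{\mathcal{M}}_x:=X_x/E_x$, and for a generically stable $\mu$, $[\mu]\in\widetilde{\mathcal{M}}_x$ is the unique class $\bar{a}/E_x$ with $\mu_{\bar{a}}=\mu$; $\mu\mapsto[\mu]$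 is a bijection between generically stable measures in $x$ and $\widetilde{\mathcal{M}}_x$. A map between hyperdefinable sets is $A$-type-definable if its graph, pulled back to representatives, is $A$-type-definable. *)

(* Defs.v *)
From HB Require Import structures.
From mathcomp Require Import all_boot all_order all_algebra.
From mathcomp Require Import all_classical all_reals all_analysis.
Set Implicit Arguments.
Unset Strict Implicit.
Unset Printing Implicit Defensive.
Import Order.TTheory GRing.Theory Num.Theory.
Import numFieldNormedType.Exports.
Local Open Scope classical_set_scope.
Local Open Scope ring_scope.
Local Open Scope card_scope.

(** * Many-sorted first-order logic *)

(* A formula has its free variables in an arbitrary type [V], each variable
   carrying a sort; a quantifier extends [V] to [option V].  A finite tuple of
   variables is given by the list of its sorts. *)

Definition ext (S V : Type) (sV : V -> S) (s : S) (o : option V) : S :=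
  match o with None => s | Some v => sV v end.

Definition sumsort (S V W : Type) (sV : V -> S) (sW : W -> S) (u : V + W) : S :=
  match u with inl v => sV v | inr w => sW w end.

Fixpoint var (S : Type) (c : seq S) : Set :=
  match c with [::] => void | _ :: c' => option (var c') end.

Fixpoint vsort (S : Type) (c : seq S) : var c -> S :=
  match c with
  | [::] => fun v => match v with end
  | s :: c' => ext (@vsort S c') s
  end.

Record signature := Signature {
  sorts : Type;
  fsym : Type;
  fdom : fsym -> seq sorts;
  fcod : fsym -> sorts;
  rsym : Type;
  rdom : rsym -> seq sorts
}.

Inductive term (L : signature) (V : Type) (sV : V -> sorts L) : sorts L -> Type :=
| TVar (v : V) : term sV (sV v)
| TApp (g : fsym L) (t : forall v : var (fdom g), term sV (vsort v)) :
    term sV (fcod g).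

Inductive fo_formula (L : signature) (V : Type) (sV : V -> sorts L) : Type :=
| FFalse
| FEq (s : sorts L) (t u : term sV s)
| FRel (r : rsym L) (t : forall v : var (rdom r), term sV (vsort v))
| FNot (phi : fo_formula sV)
| FOr (phi psi : fo_formula sV)
| FEx (s : sorts L) (phi : fo_formula (ext sV s)).

Arguments TVar {L V sV} v.
Arguments FFalse {L V sV}.
Arguments FRel {L V sV} r t.

Fixpoint tsubst (L : signature) (V W : Type) (sV : V -> sorts L)
    (sW : W -> sorts L) (f : forall v, term sW (sV v)) (s : sorts L)
    (t : term sV s) : term sW s :=
  match t with
  | TVar v => f v
  | TApp g a => TApp (fun v => tsubst f (a v))
  end.

Definition weaken (L : signature) (V : Type) (sV : V -> sorts L) (r s : sorts L)
    (t : term sV s) : term (ext sV r) s :=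
  @tsubst L V (option V) sV (ext sV r) (fun v => @TVar _ _ (ext sV r) (Some v))
    s t.

Definition upsubst (L : signature) (V W : Type) (sV : V -> sorts L)
    (sW : W -> sorts L) (s : sorts L) (f : forall v, term sW (sV v))
    (o : option V) : term (ext sW s) (ext sV s o) :=
  match o with
  | None => @TVar _ _ (ext sW s) None
  | Some v => weaken s (f v)
  end.

Fixpoint fsubst (L : signature) (V : Type) (sV : V -> sorts L)
    (phi : fo_formula sV) :
    forall (W : Type) (sW : W -> sorts L),
      (forall v, term sW (sV v)) -> fo_formula sW :=
  match phi with
  | FFalse => fun W sW f => FFalse
  | FEq s t u => fun W sW f => FEq (tsubst f t) (tsubst f u)
  | FRel r a => fun W sW f => FRel r (fun v => tsubst f (a v))
  | FNot p => fun W sW f => FNot (fsubst p f)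
  | FOr p q => fun W sW f => FOr (fsubst p f) (fsubst q f)
  | FEx s p => fun W sW f => FEx (fsubst p (upsubst s f))
  end.

Record structure (L : signature) := Structure {
  carrier : sorts L -> Type;
  carrier_inh : forall s, inhabited (carrier s);
  fint : forall g : fsym L,
    (forall v : var (fdom g), carrier (vsort v)) -> carrier (fcod g);
  rint : forall r : rsym L,
    (forall v : var (rdom r), carrier (vsort v)) -> Prop
}.

Section Semantics.
Variables (L : signature) (M : structure L).

Definition asg (V : Type) (sV : V -> sorts L) : Type :=
  forall v : V, carrier M (sV v).

Definition ext_asg (V : Type) (sV : V -> sorts L) (e : asg sV) (s : sorts L)
    (a : carrier M s) : asg (ext sV s) :=
  fun o => match o with None => a | Some v => e v end.

Definition join (V W : Type) (sV : V -> sorts L) (sW : W -> sorts L)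
    (e : asg sV) (e' : asg sW) : asg (sumsort sV sW) :=
  fun u => match u with inl v => e v | inr w => e' w end.

Definition left_part (V W : Type) (sV : V -> sorts L) (sW : W -> sorts L)
    (e : asg (sumsort sV sW)) : asg sV := fun v => e (inl v).

Definition right_part (V W : Type) (sV : V -> sorts L) (sW : W -> sorts L)
    (e : asg (sumsort sV sW)) : asg sW := fun w => e (inr w).

Fixpoint teval (V : Type) (sV : V -> sorts L) (e : asg sV) (s : sorts L)
    (t : term sV s) : carrier M s :=
  match t with
  | TVar v => e v
  | TApp g a => fint (fun v => teval e (a v))
  end.

Fixpoint sat (V : Type) (sV : V -> sorts L) (phi : fo_formula sV) :
    asg sV -> Prop :=
  match phi with
  | FFalse => fun _ => False
  | FEq s t u => fun e => teval e t = teval e u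
  | FRel r a => fun e => rint (fun v => teval e (a v))
  | FNot p => fun e => ~ sat p e
  | FOr p q => fun e => sat p e \/ sat q e
  | FEx s p => fun e => exists a : carrier M s, sat p (ext_asg e a)
  end.

(* M^x *)
Definition pt (x : seq (sorts L)) : Type := asg (@vsort _ x).

Fixpoint cat_pt (y z : seq (sorts L)) : pt y -> pt z -> pt (y ++ z) :=
  match y return pt y -> pt z -> pt (y ++ z) with
  | [::] => fun _ c => c
  | s :: y' => fun b c =>
      @ext_asg _ (@vsort _ (y' ++ z))
        (@cat_pt y' z (fun v => b (Some v)) c) s (b None)
  end.

End Semantics.

(** * Theories, NIP *)

Definition sentence (L : signature) : Type := fo_formula (@vsort (sorts L) [::]).

Definition holds (L : signature) (M : structure L) (p : sentence L) : Prop :=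
  forall e : pt M [::], sat p e.

Definition models (L : signature) (M : structure L) (T : set (sentence L)) :
    Prop :=
  forall p, T p -> holds M p.

Definition entails (L : signature) (T : set (sentence L)) (p : sentence L) :
    Prop :=
  forall M : structure L, models M T -> holds M p.

Definition complete_theory (L : signature) (T : set (sentence L)) : Prop :=
  forall p, entails T p \/ entails T (FNot p).

(* A formula phi(x,y) together with its tuple of variables y. *)
Record xform (L : signature) (x : seq (sorts L)) := XForm {
  yctx : seq (sorts L);
  fml : fo_formula (sumsort (@vsort _ x) (@vsort _ yctx))
}.

Definition inst (L : signature) (M : structure L) (x : seq (sorts L))
    (phi : xform x) (b : pt M (yctx phi)) : set (pt M x) :=
  [set a | sat (fml phi) (join a b)].

Definition NIP (L : signature) (T : set (sentence L)) : Prop :=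
  forall M : structure L, models M T ->
  forall (x : seq (sorts L)) (phi : xform x),
  ~ exists (a : nat -> pt M x) (b : set nat -> pt M (yctx phi)),
      forall (i : nat) (I : set nat), inst (b I) (a i) <-> I i.

(* The variables of y and of z, as terms in the variables of y ++ z. *)
Fixpoint lvar (L : signature) (y z : seq (sorts L)) :
    forall v : var y, term (@vsort _ (y ++ z)) (vsort v) :=
  match y return forall v : var y, term (@vsort _ (y ++ z)) (vsort v) with
  | [::] => fun v => match v with end
  | s :: y' => fun v =>
      match v return
        term (ext (@vsort _ (y' ++ z)) s) (ext (@vsort _ y') s v) with
      | None => @TVar L _ (ext (@vsort _ (y' ++ z)) s) None
      | Some w => weaken s (@lvar L y' z w)
      end
  end.

Fixpoint rvar (L : signature) (y z : seq (sorts L)) (w : var z) :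
    term (@vsort _ (y ++ z)) (vsort w) :=
  match y return term (@vsort _ (y ++ z)) (vsort w) with
  | [::] => TVar w
  | s :: y' => weaken s (@rvar L y' z w)
  end.

(* phi1(x,y1) \/ phi2(x,y2), as a formula in x and in the concatenation of the
   tuples y1 and y2 (variables shared by name between y1 and y2 are thus kept
   apart, as the two formulas receive independent parameters b1 and b2). *)
Definition or_xform (L : signature) (x : seq (sorts L)) (phi1 phi2 : xform x) :
    xform x :=
  let sxy := sumsort (@vsort _ x) (@vsort _ (yctx phi1 ++ yctx phi2)) in
  let inr_term s (t : term (@vsort _ (yctx phi1 ++ yctx phi2)) s) :=
    @tsubst _ _ _ _ sxy (fun v => @TVar _ _ sxy (inr v)) s t in
  XForm (FOr
    (@fsubst _ _ _ (fml phi1) _ sxy (fun u =>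
       match u return term sxy (sumsort (@vsort _ x) (@vsort _ (yctx phi1)) u)
       with
       | inl v => @TVar _ _ sxy (inl v)
       | inr w => inr_term _ (lvar (yctx phi2) w)
       end))
    (@fsubst _ _ _ (fml phi2) _ sxy (fun u =>
       match u return term sxy (sumsort (@vsort _ x) (@vsort _ (yctx phi2)) u)
       with
       | inl v => @TVar _ _ sxy (inl v)
       | inr w => inr_term _ (rvar (yctx phi1) w)
       end))).

(** * Parameters, types, monster models *)

Definition elem (L : signature) (M : structure L) : Type := {s & carrier M s}.

Definition in_params (L : signature) (M : structure L) (A : set (elem M))
    (V : Type) (sV : V -> sorts L) (e : asg M sV) : Prop :=
  forall v, A (existT _ (sV v) (e v)).

(* L(A)-formulas in the variables V. *)
Record pform (L : signature) (M : structure L) (A : set (elem M)) (V : Type)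
    (sV : V -> sorts L) := PForm {
  pctx : seq (sorts L);
  pfml : fo_formula (sumsort sV (@vsort _ pctx));
  ppar : pt M pctx;
  ppar_in : in_params A ppar
}.
Arguments ppar {L M A V sV} p.

Definition psat (L : signature) (M : structure L) (A : set (elem M)) (V : Type)
    (sV : V -> sorts L) (psi : pform A sV) (e : asg M sV) : Prop :=
  sat (pfml psi) (join e (ppar psi)).

Definition pneg (L : signature) (M : structure L) (A : set (elem M)) (V : Type)
    (sV : V -> sorts L) (psi : pform A sV) : pform A sV :=
  @PForm L M A V sV (pctx psi) (FNot (pfml psi)) (ppar psi)
    (@ppar_in L M A V sV psi).

Definition definable (L : signature) (M : structure L) (A : set (elem M))
    (V : Type) (sV : V -> sorts L) (D : set (asg M sV)) : Prop :=
  exists psi : pform A sV, D = [set e | psat psi e].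

Definition definable_map (L : signature) (M : structure L) (A : set (elem M))
    (x y : seq (sorts L)) (f : pt M x -> pt M y) : Prop :=
  definable A
    [set e : asg M (sumsort (@vsort _ x) (@vsort _ y)) |
       f (left_part e) = right_part e].

Definition card_lt (X Y : Type) (A : set X) (B : set Y) : Prop :=
  (A #<= B) /\ ~ (B #<= A).

(* |A| < kappa, where the cardinal kappa is given as the cardinality of K. *)
Definition small (K X : Type) (A : set X) : Prop := card_lt A [set: K].

Definition strong_limit (K : Type) : Prop :=
  small K [set: nat] /\
  forall X : set K, small K X -> small K [set Y : set K | Y `<=` X].

Definition finitely_satisfiable (L : signature) (M : structure L)
    (A : set (elem M)) (V : Type) (sV : V -> sorts L) (p : set (pform A sV)) :
    Prop :=
  forall q : set (pform A sV), finite_set q -> q `<=` p ->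
    exists e : asg M sV, forall psi, q psi -> psat psi e.

Definition saturated (K : Type) (L : signature) (M : structure L) : Prop :=
  forall (A : set (elem M)) (x : seq (sorts L)) (p : set (pform A (@vsort _ x))),
    small K A -> finitely_satisfiable p ->
    exists a : pt M x, forall psi, p psi -> psat psi a.

Definition map_asg (L : signature) (M N : structure L)
    (g : forall s, carrier M s -> carrier N s) (V : Type) (sV : V -> sorts L)
    (e : asg M sV) : asg N sV :=
  fun v => g (sV v) (e v).

Definition automorphism (L : signature) (M : structure L)
    (g : forall s, carrier M s -> carrier M s) : Prop :=
  [/\ forall s, bijective (g s),
      forall (h : fsym L) (a : pt M (fdom h)),
        g _ (fint a) = fint (map_asg g a) &
      forall (r : rsym L) (a : pt M (rdom r)),
        rint (map_asg g a) <-> rint a].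

(* [g] is only relevant on the small set [A]. *)
Definition strongly_homogeneous (K : Type) (L : signature) (M : structure L) :
    Prop :=
  forall (A : set (elem M)) (g : forall s, carrier M s -> carrier M s),
    small K A ->
    (forall (z : seq (sorts L)) (c : pt M z) (phi : fo_formula (@vsort _ z)),
       in_params A c -> (sat phi c <-> sat phi (map_asg g c))) ->
    exists h : forall s, carrier M s -> carrier M s,
      automorphism h /\
      forall s (a : carrier M s), A (existT _ s a) -> h s a = g s a.

(* kappa is a strong limit cardinal > |T| and M is a kappa-saturated, strongly
   kappa-homogeneous model of T. *)
Record monster_model (K : Type) (L : signature) (T : set (sentence L))
    (M : structure L) : Prop := MonsterModel {
  monster_strong_limit : strong_limit K;
  monster_sorts : small K [set: sorts L];
  monster_fsyms : small K [set: fsym L];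
  monster_rsyms : small K [set: rsym L];
  monster_models : models M T;
  monster_saturated : saturated K M;
  monster_homogeneous : strongly_homogeneous K M
}.

(* The subset [B] of M is the universe of an elementary submodel. *)
Definition elementary_submodel (L : signature) (M : structure L)
    (B : set (elem M)) : Prop :=
  exists (N : structure L) (j : forall s, carrier N s -> carrier M s),
    (forall (z : seq (sorts L)) (phi : fo_formula (@vsort _ z)) (c : pt N z),
       sat phi c <-> sat phi (map_asg j c)) /\
    B = [set p | exists a : carrier N (projT1 p), projT2 p = j _ a].

(** ** The space S_y(B) of complete types over B *)

Section TypeSpace.
Variables (L : signature) (M : structure L) (B : set (elem M)).
Variable y : seq (sorts L).

Definition complete_type (p : set (pform B (@vsort _ y))) : Prop :=
  finitely_satisfiable p /\ forall psi, p psi \/ p (pneg psi).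

Definition type_space : Type := {p | complete_type p}.

HB.instance Definition _ := gen_eqMixin type_space.
HB.instance Definition _ := gen_choiceMixin type_space.

Definition type_subbase : set (set type_space) :=
  [set U | exists psi : pform B (@vsort _ y), U = [set p | sval p psi]].

HB.instance Definition _ :=
  isSubBaseTopological.Build type_space type_subbase id.

Lemma tp_complete (b : pt M y) :
  complete_type [set psi : pform B (@vsort _ y) | psat psi b].
Proof.
split; last by move=> psi; exact: EM.
by move=> q _ sub; exists b => psi /sub.
Qed.

Definition tp (b : pt M y) : type_space := exist _ _ (tp_complete b).

End TypeSpace.

(** * Keisler measures *)

(* A measure is a function on all subsets of M^x of which only the values on
   the sets definable with parameters from M are relevant. *)

Section Measures.
Variables (R : realType) (K : Type) (L : signature) (M : structure L).

Definition keisler_measure (x : seq (sorts L)) (mu : set (pt M x) -> R) : Prop :=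
  [/\ forall D, definable setT D -> 0 <= mu D,
      mu setT = 1 &
      forall D D', definable setT D -> definable setT D' ->
        D `&` D' = set0 -> mu (D `|` D') = mu D + mu D'].

Definition invariant_over (B : set (elem M)) (x : seq (sorts L))
    (mu : set (pt M x) -> R) : Prop :=
  forall (phi : xform x) (b b' : pt M (yctx phi)),
    tp B b = tp B b' -> mu (inst b) = mu (inst b').

Definition definable_over (B : set (elem M)) (x : seq (sorts L))
    (mu : set (pt M x) -> R) : Prop :=
  invariant_over B mu /\
  forall phi : xform x,
    exists F : type_space B (yctx phi) -> R,
      continuous F /\ forall b, F (tp B b) = mu (inst b).

Definition finitely_satisfiable_in (B : set (elem M)) (x : seq (sorts L))
    (mu : set (pt M x) -> R) : Prop :=
  forall (phi : xform x) (b : pt M (yctx phi)), 0 < mu (inst b) ->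
    exists a : pt M x, in_params B a /\ inst b a.

Definition generically_stable (x : seq (sorts L)) (mu : set (pt M x) -> R) :
    Prop :=
  keisler_measure mu /\
  exists B : set (elem M),
    [/\ small K B, elementary_submodel B, definable_over B mu &
        finitely_satisfiable_in B mu].

Definition pushforward (x y : seq (sorts L)) (f : pt M x -> pt M y)
    (mu : set (pt M x) -> R) : set (pt M y) -> R :=
  fun D => mu (f @^-1` D).

(** * Coding of generically stable measures *)

Definition Av (x : seq (sorts L)) (m : nat) (a : 'I_m -> pt M x)
    (D : set (pt M x)) : R :=
  m%:R^-1 * #|[pred i | `[< D (a i) >]]|%:R.

Definition approximation (x : seq (sorts L)) (mu : set (pt M x) -> R)
    (phi : xform x) (eps : R) (m : nat) (a : 'I_m -> pt M x) : Prop :=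
  forall b : pt M (yctx phi), `|Av a (inst b) - mu (inst b)| <= eps.

(* The defining property of the numbers n_{phi,eps}; they are positive since
   Av is an average over n_{phi,eps} points. *)
Definition approximation_numbers
    (n : forall x : seq (sorts L), xform x -> R -> nat) : Prop :=
  forall (x : seq (sorts L)) (phi : xform x) (eps : R), 0 < eps ->
    (0 < n x phi eps)%N /\
    forall mu : set (pt M x) -> R, generically_stable mu ->
      exists a : 'I_(n x phi eps) -> pt M x, approximation mu phi eps a.

Variable n : forall x : seq (sorts L), xform x -> R -> nat.

(* The indices k : nat stand for k.+1 >= 1. *)
Definition inv1 (k : nat) : R := k.+1%:R^-1.

(* The variables of the tuples indexed by (phi, 1/k): the coordinate v : var x
   of the i-th point of the (phi, 1/k)-block. *)
Record code_var (x : seq (sorts L)) := CodeVar {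
  cv_form : xform x;
  cv_k : nat;
  cv_i : 'I_(n cv_form (inv1 cv_k));
  cv_v : var x
}.

Definition code_sort (x : seq (sorts L)) (v : code_var x) : sorts L :=
  vsort (cv_v v).

Definition code (x : seq (sorts L)) : Type := asg M (@code_sort x).

Definition block (x : seq (sorts L)) (a : code x) (phi : xform x) (k : nat) :
    'I_(n phi (inv1 k)) -> pt M x :=
  fun i v => a (CodeVar i v).
Arguments block {x} a phi k i v.

Definition code_set (x : seq (sorts L)) : set (code x) :=
  [set a |
     (forall (phi : xform x) (k k1 k2 : nat) (b : pt M (yctx phi)),
        (k <= k1)%N -> (k <= k2)%N ->
        `|Av (block a phi k1) (inst b) - Av (block a phi k2) (inst b)|
          <= 2 * inv1 k) /\
     (forall (phi1 phi2 : xform x) (k : nat)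
        (b1 : pt M (yctx phi1)) (b2 : pt M (yctx phi2)),
        inst b1 `&` inst b2 = set0 ->
        `|Av (block a (or_xform phi1 phi2) k)
             (@inst L M x (or_xform phi1 phi2) (cat_pt b1 b2))
          - (Av (block a phi1 k) (inst b1) + Av (block a phi2 k) (inst b2))|
          <= 3 * inv1 k)].

Definition code_eqv (x : seq (sorts L)) (a a' : code x) : Prop :=
  forall (phi : xform x) (k : nat) (b : pt M (yctx phi)),
    `|Av (block a phi k) (inst b) - Av (block a' phi k) (inst b)|
      <= 4 * inv1 k.

(* mu_a = mu *)
Definition codes (x : seq (sorts L)) (a : code x) (mu : set (pt M x) -> R) :
    Prop :=
  forall (phi : xform x) (b : pt M (yctx phi)),
    (fun k => Av (block a phi k) (inst b)) @ \oo --> mu (inst b).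

End Measures.

(** * Hyperdefinable sets and type-definable maps between them *)

Section Hyperdefinable.
Variables (K : Type) (L : signature) (M : structure L).

Definition type_definable (A : set (elem M)) (V : Type) (sV : V -> sorts L)
    (X : set (asg M sV)) : Prop :=
  exists P : set (pform A sV),
    small K P /\ X = [set e | forall psi, P psi -> psat psi e].

Definition eqv_class (V : Type) (sV : V -> sorts L) (X : set (asg M sV))
    (E : asg M sV -> asg M sV -> Prop) (a : asg M sV) : set (asg M sV) :=
  [set a' | X a' /\ E a a'].

(* X / E *)
Definition quotient (V : Type) (sV : V -> sorts L) (X : set (asg M sV))
    (E : asg M sV -> asg M sV -> Prop) : Type :=
  {C : set (asg M sV) | exists2 a, X a & C = eqv_class X E a}.

(* The relation [G] is (the graph of) a function X / E -> X' / E', and it is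
   A-type-definable when pulled back to representatives. *)
Definition type_definable_map (A : set (elem M)) (V W : Type)
    (sV : V -> sorts L) (sW : W -> sorts L)
    (X : set (asg M sV)) (E : asg M sV -> asg M sV -> Prop)
    (X' : set (asg M sW)) (E' : asg M sW -> asg M sW -> Prop)
    (G : quotient X E -> quotient X' E' -> Prop) : Prop :=
  (forall C, exists! D, G C D) /\
  type_definable A
    [set e : asg M (sumsort sV sW) |
       exists C D, [/\ G C D, sval C (left_part e) & sval D (right_part e)]].

End Hyperdefinable.

Section CodingSpace.
Variables (R : realType) (K : Type) (L : signature) (M : structure L).
Variable n : forall x : seq (sorts L), xform x -> R -> nat.

(* X_x / E_x *)
Definition measure_sort (x : seq (sorts L)) : Type :=
  quotient (@code_set R L M n x) (@code_eqv R L M n x).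

(* mu is generically stable and C = [mu] *)
Definition is_class_of (x : seq (sorts L)) (mu : set (pt M x) -> R)
    (C : measure_sort x) : Prop :=
  generically_stable K mu /\
  exists a : code M n x,
    [/\ code_set a, codes a mu &
        sval C = eqv_class (@code_set R L M n x) (@code_eqv R L M n x) a].

(* The graph of [mu] |-> [f_* mu]. *)
Definition pushforward_graph (x y : seq (sorts L)) (f : pt M x -> pt M y)
    (C : measure_sort x) (D : measure_sort y) : Prop :=
  exists mu : set (pt M x) -> R,
    is_class_of mu C /\ is_class_of (pushforward f mu) D.

End CodingSpace.

(* Main.v *)
Require Import Defs.
From mathcomp Require Import all_boot all_order all_algebra.
From mathcomp Require Import all_classical all_reals all_analysis.
From mathcomp Require Import lra.
Require Import Defs.

(** The push-forward is described on codes by one system of closed conditions.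
    For a formula [psi] in [y], the preimages under [f] of the instances of
    [psi] are instances of a single formula [theta psi] in [x], the parameters
    that define [f] being absorbed into those of [theta psi].  If [a] codes [mu],
    the averages of the [(theta psi, 1/k)]-block of [a] are within [2/k] of [mu]
    on the instances of [theta psi], that is, of [f_* mu] on the instances of
    [psi]; and if [d] codes [f_* mu], so are the averages of the
    [(psi, 1/k)]-block of [d].  Hence [d] codes [f_* mu] if and only if, for all
    [psi] and [k], these two averages differ by at most [4/k] on every instance
    of [psi] ([pushforward_graph_codes]).  An average over [m] points takes its
    value according to which of the [m] points satisfy the formula, so an
    inequality between averages is a Boolean combination of formulas, and
    quantifying over the parameters of the instances keeps it first-order
    ([definable_pattern], [definable_close_averages]).  The set of codes is
    type-definable for the same reason ([type_definable_code_set]).  There are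
    few enough of these conditions because there are few formulas
    ([small_xform]).

    That this relation is a function needs the dictionary between codes and
    measures.  The averages of a code form a Cauchy sequence, whose limit is a
    Keisler measure [mu] ([code_measure]).  Any Keisler measure that is a uniform
    limit of averages on every formula is generically stable
    ([approximable_gs]): a small elementary submodel that contains all the
    points averaged over (a Skolem hull, [small_hull]) decides, up to any given
    error, the measure of an instance from the type of its parameters, and
    contains a realization of every instance of positive measure.  This applies
    to [mu], and also to the push-forward of a generically stable measure, since
    the image under [f] of an approximation on [theta psi] is an approximation
    on [psi] ([pushforward_gs]).  Conversely every generically stable measure has
    a code ([gs_code]), and two codes are equivalent exactly when their measures
    agree on definable sets ([code_eqvP]), a property that push-forward
    preserves. *)

Set Implicit Arguments.
Unset Strict Implicit.
Unset Printing Implicit Defensive.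
Import Order.TTheory GRing.Theory Num.Theory.
Import numFieldNormedType.Exports.
Local Open Scope classical_set_scope.
Local Open Scope ring_scope.
Local Open Scope card_scope.

(** * Small sets *)

Notation smallT K U := (small K [set: U]).

Lemma card_le_injT (U V : Type) :
  ([set: U] #<= [set: V]) <-> exists f : U -> V, injective f.
Proof.
split=> [/card_leP[f]|[f f_inj]]; last first.
  by rewrite -(card_le_eql (@inj_card_eq _ _ setT f (in2W f_inj))); exact: card_leT.
exists (fun u => val (f (to_setT u))) => u v /val_inj fuv.
by have /(congr1 val) := 'inj_f (mem_set I) (mem_set I) fuv.
Qed.

Lemma small_le (K U V : Type) (A : set U) (B : set V) :
  A #<= B -> small K B -> small K A.
Proof.
move=> AB [BK nKB]; split; first exact: card_le_trans AB BK.
by move=> KA; apply: nKB; exact: card_le_trans KA AB.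
Qed.

Lemma small_inj (K U V : Type) (f : U -> V) :
  injective f -> smallT K V -> smallT K U.
Proof. by move=> f_inj; apply: small_le; apply/card_le_injT; exists f. Qed.

Lemma small_range (K U V : Type) (f : U -> V) : smallT K U -> small K (range f).
Proof. by apply: small_le; exact: card_image_le. Qed.

Lemma small_sig (K U : Type) (A : set U) : small K A -> smallT K {u | A u}.
Proof.
apply: small_le; apply: (@card_le_trans _ _ _ (range (@sval _ A))).
  rewrite (card_le_eqr (@inj_card_eq _ _ setT _ (in2W _))) //.
  by move=> [u Au] [v Av] /= uv; exact: eq_exist.
by apply: subset_card_le => _ [[u Au] _ <-].
Qed.

(** By Zorn's lemma there is a maximal partial bijection; it cannot miss both an
    element of [U] and one of [V]. *)
Lemma comparable_types (U V : Type) :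
  (exists f : U -> V, injective f) \/ (exists f : V -> U, injective f).
Proof.
pose P (G : set (U * V)) := forall p q, G p -> G q -> p.1 = q.1 <-> p.2 = q.2.
have [|G [PG Gmax]] := @Zorn_bigcup _ P.
  move=> F FP Ftot p q [X FX Xp] [Y FY Yq].
  have [XY|YX] := Ftot _ _ FX FY.
    by apply: (FP _ FY) => //; exact: XY.
  by apply: (FP _ FX) => //; exact: YX.
have [Gdom|/existsNP[u Gu]] := pselect (forall u, exists v, G (u, v)).
  left; have [f fG] := choice Gdom; exists f => u u' fuu'.
  by have [_] := PG _ _ (fG u) (fG u'); apply.
have [Gcod|/existsNP[v Gv]] := pselect (forall v, exists u, G (u, v)).
  right; have [f fG] := choice Gcod; exists f => v v' fvv'.
  by have [+ _] := PG _ _ (fG v) (fG v'); apply.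
exfalso; apply: (Gmax (G `|` [set (u, v)])).
  split; last by move=> sub; apply: Gu; exists v; apply: sub; right.
  by move=> p Gp; left.
move=> [a b] [a' b'] [Gp|[-> ->]] [Gq|[-> ->]] //=.
- exact: (PG _ _ Gp Gq).
- by split=> e; [case: Gu; exists b; rewrite -e|case: Gv; exists a; rewrite -e].
- by split=> e; [case: Gu; exists b'; rewrite e|case: Gv; exists a'; rewrite e].
Qed.

(** Kuratowski pairs, so that no arithmetic of infinite cardinals is needed. *)
Lemma kuratowski_inj (W : Type) :
  injective (fun p : W * W =>
    [set X : set W | X = [set p.1] \/ X = [set p.1; p.2]]).
Proof.
move=> [u v] [u' v'] /= E.
have uE : u = u'.
  have : [set X : set W | X = [set u'] \/ X = [set u'; v']] [set u].
    by rewrite -E; left.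
  case=> e; first by have : [set u'] u by rewrite -e.
  by have : [set u] u' by rewrite e; left.
rewrite -{u'}uE in E *.
have h : [set u; v] = [set u] \/ [set u; v] = [set u; v'].
  suff : [set X : set W | X = [set u] \/ X = [set u; v']] [set u; v] by [].
  by rewrite -E; right.
have h' : [set u; v'] = [set u] \/ [set u; v'] = [set u; v].
  suff : [set X : set W | X = [set u] \/ X = [set u; v]] [set u; v'] by [].
  by rewrite E; right.
have vE : v = u \/ v = v'.
  have : [set u; v] v by right.
  by case: h => -> []; [left|left|right].
have vE' : v' = u \/ v' = v.
  have : [set u; v'] v' by right.
  by case: h' => -> []; [left|left|right].
by case: vE vE' => [->|->//] [->|->].
Qed.

Section StrongLimit.
Variables (K : Type) (K_lim : strong_limit K).

Lemma small_countable (U : Type) (f : U -> nat) : injective f -> smallT K U.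
Proof. by move=> f_inj; apply: (small_inj f_inj); case: K_lim. Qed.

(** Being a strong limit speaks of subsets of [K]; an injection of [U] into [K]
    embeds the subsets of [U] into those of its range. *)
Lemma small_set (U : Type) : smallT K U -> smallT K (set U).
Proof.
move=> sU; have [UK _] := sU.
have [h h_inj] := (card_le_injT _ _).1 UK.
have := K_lim.2 _ (small_range h sU); apply: small_le.
have im_inj : injective (fun Y : set U => h @` Y).
  suff sub (Y Z : set U) : h @` Y = h @` Z -> Y `<=` Z.
    by move=> Y Z YZ; apply/seteqP; split; exact: sub.
  move=> YZ u Yu; have [v Zv /h_inj <-//] : (h @` Z) (h u) by rewrite -YZ; exists u.
rewrite -(card_le_eql (@inj_card_eq _ _ setT _ (in2W im_inj))).
by apply: subset_card_le => _ [Y _ <-] _ [u _ <-]; exists u.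
Qed.

(** By comparability both factors embed into the larger one, and the Kuratowski
    pairs of a small type are subsets of its power set. *)
Lemma small_prod (U V : Type) : smallT K U -> smallT K V -> smallT K (U * V).
Proof.
move=> sU sV.
have sq W : smallT K W -> smallT K (W * W).
  by move=> sW; apply: (small_inj (@kuratowski_inj W)); do 2 apply: small_set.
have [[f f_inj]|[f f_inj]] := comparable_types U V.
  apply: (@small_inj _ _ _ (fun p => (f p.1, p.2))) (sq _ sV).
  by move=> [u v] [u' v'] /= [/f_inj -> ->].
apply: (@small_inj _ _ _ (fun p => (p.1, f p.2))) (sq _ sU).
by move=> [u v] [u' v'] /= [-> /f_inj ->].
Qed.

Lemma small_sum (U V : Type) : smallT K U -> smallT K V -> smallT K (U + V).
Proof.
move=> sU sV.
have dup W : smallT K W -> smallT K (bool * W).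
  by apply: small_prod; apply: (@small_countable _ nat_of_bool) => [[] []].
have [[f f_inj]|[f f_inj]] := comparable_types U V.
  pose g (p : U + V) := match p with inl u => (true, f u) | inr v => (false, v) end.
  apply: (@small_inj _ _ _ g) (dup _ sV).
  by move=> [u|v] [u'|v'] //= [] => [/f_inj ->|->].
pose g (p : U + V) := match p with inl u => (true, u) | inr v => (false, f v) end.
apply: (@small_inj _ _ _ g) (dup _ sU).
by move=> [u|v] [u'|v'] //= [] => [->|/f_inj ->].
Qed.

(** A sequence is determined by its graph, a subset of [nat * U]. *)
Lemma small_seq (U : Type) : smallT K U -> smallT K (seq U).
Proof.
move=> sU; pose graph (s : seq U) := [set p : nat * U | onth s p.1 = Some p.2].
have sub s t : graph s = graph t -> forall i u, onth s i = Some u -> onth t i = Some u.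
  by move=> st i u siu; have : graph t (i, u) by rewrite -st.
apply: (@small_inj _ _ _ graph).
  move=> s t st; apply: eq_from_onth => i.
  case Es: (onth s i) => [u|]; first by rewrite (sub _ _ st _ _ Es).
  by case Et: (onth t i) => [u|//]; rewrite -Es (sub _ _ (esym st) _ _ Et).
apply: small_set; apply: small_prod => //.
by apply: (@small_countable _ id).
Qed.

Lemma small_tree (U : Type) : smallT K U -> smallT K (GenTree.tree U).
Proof.
move=> sU; apply: (@small_inj _ _ _ (@GenTree.encode U)).
  exact: pcan_inj (GenTree.codeK U).
apply: small_seq; apply: small_sum => //.
by apply: (@small_countable _ id).
Qed.

End StrongLimit.

(** * Counting formulas *)

Lemma existT_inj (I : Type) (P : I -> Type) (i : I) (u v : P i) :
  existT P i u = existT P i v -> u = v.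
Proof.
by move=> e; have := projT2_eq e; rewrite (Prop_irrelevance (projT1_eq e) erefl).
Qed.

Fixpoint var_index (S : Type) (c : seq S) : var c -> nat :=
  match c with
  | [::] => fun v => match v with end
  | _ :: _ => fun o => if o is Some v then (var_index v).+1 else 0%N
  end.

Lemma var_index_inj (S : Type) (c : seq S) : injective (@var_index S c).
Proof. by elim: c => [[]|s c IH] [v|] [w|] //= [/IH ->]. Qed.

Fixpoint vars (S : Type) (c : seq S) : seq (var c) :=
  match c with [::] => [::] | _ :: c' => None :: map Some (vars c') end.

Lemma eq_map_vars (S U : Type) (c : seq S) (F G : var c -> U) :
  map F (vars c) = map G (vars c) -> F =1 G.
Proof.
elim: c F G => [|s c IH] F G /= => [_ []|[FG0]]; rewrite -!map_comp => /IH FG.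
by case=> [v|//]; exact: FG.
Qed.

Definition label (L : signature) (X : Type) : Type :=
  ((sorts L + rsym L) + (fsym L + X))%type.

Fixpoint term_code (L : signature) (V X : Type) (sV : V -> sorts L) (c : V -> X)
    (s : sorts L) (t : term sV s) : GenTree.tree (label L X) :=
  match t with
  | TVar v => GenTree.Leaf (inr (inr (c v)))
  | TApp g a => GenTree.Node 0 (GenTree.Leaf (inr (inl g)) ::
      [seq term_code c (a v) | v <- vars (fdom g)])
  end.

Lemma term_code_inj (L : signature) (V X : Type) (sV : V -> sorts L) (c : V -> X) :
  injective c -> forall s (t : term sV s) s' (t' : term sV s'),
    term_code c t = term_code c t' ->
    existT (term sV) s t = existT (term sV) s' t'.
Proof.
move=> c_inj s; elim=> [v|g a IH] s' [v'|g' a'] //= [].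
  by move=> /c_inj ->.
move=> gg'; rewrite -{g'}gg' in a' * => /eq_map_vars aa'.
suff -> : a = a' by [].
apply: functional_extensionality_dep => v.
exact: existT_inj (IH _ _ _ (aa' v)).
Qed.

(** Variables are named by numbers, in the manner of de Bruijn indices, so that
    the names do not change their type under a quantifier. *)
Definition shift_name (V : Type) (c : V -> nat) (o : option V) : nat :=
  if o is Some v then (c v).+1 else 0%N.

Fixpoint fo_code (L : signature) (V : Type) (sV : V -> sorts L) (c : V -> nat)
    (phi : fo_formula sV) : GenTree.tree (label L nat) :=
  match phi with
  | FFalse => GenTree.Node 0 [::]
  | FEq s t u =>
      GenTree.Node 1 [:: GenTree.Leaf (inl (inl s)); term_code c t; term_code c u]
  | FRel r a => GenTree.Node 2 (GenTree.Leaf (inl (inr r)) ::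
      [seq term_code c (a v) | v <- vars (rdom r)])
  | FNot p => GenTree.Node 3 [:: fo_code c p]
  | FOr p q => GenTree.Node 4 [:: fo_code c p; fo_code c q]
  | FEx s p =>
      GenTree.Node 5 [:: GenTree.Leaf (inl (inl s)); fo_code (shift_name c) p]
  end.

Lemma fo_code_inj (L : signature) (V : Type) (sV : V -> sorts L) (c : V -> nat) :
  injective c -> injective (@fo_code L V sV c).
Proof.
move=> c_inj phi; elim: phi c c_inj =>
    {V sV} [V sV|V sV s t u|V sV r a|V sV p IHp|V sV p IHp q IHq|V sV s p IHp]
    c c_inj.
- by case.
- case=> //= s' t' u' [ss']; rewrite -{s'}ss' in t' u' *.
  move=> /(term_code_inj c_inj) tt' /(term_code_inj c_inj) uu'.
  by rewrite (existT_inj tt') (existT_inj uu').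
- case=> //= r' a' [rr']; rewrite -{r'}rr' in a' * => /eq_map_vars aa'.
  suff -> : a = a' by [].
  apply: functional_extensionality_dep => v.
  exact: existT_inj (term_code_inj c_inj (aa' v)).
- by case=> //= p' [/(IHp _ c_inj) ->].
- by case=> //= p' q' [/(IHp _ c_inj) -> /(IHq _ c_inj) ->].
- case=> //= s' p' [ss']; rewrite -{s'}ss' in p' * => /IHp -> //.
  by move=> [v|] [w|] //= [/c_inj ->].
Qed.

Section SmallSyntax.
Variables (K : Type) (K_lim : strong_limit K) (L : signature).
Hypotheses (sorts_small : smallT K (sorts L)) (fsym_small : smallT K (fsym L)).

Lemma small_terms (V : Type) (sV : V -> sorts L) :
  smallT K V -> smallT K (rsym L) -> smallT K {s & term sV s}.
Proof.
move=> sV_small rsym_small.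
apply: (@small_inj _ _ _ (fun p => term_code (@id V) (projT2 p))).
  by move=> [s t] [s' t'] /= /(term_code_inj (@inj_id V)).
by apply: small_tree => //; do 2 apply: small_sum => //; exact: small_sum.
Qed.

Hypothesis rsym_small : smallT K (rsym L).

Lemma small_labels : smallT K (GenTree.tree (label L nat)).
Proof.
apply: small_tree => //; apply: small_sum => //; apply: small_sum => //.
by apply: (@small_countable _ _ _ id).
Qed.

(** A formula in the variables [x] and [y] is recovered from [y] and its code
    once the variables of [x] get even names and those of [y] odd names. *)
Lemma small_xform (x : seq (sorts L)) : smallT K (xform x).
Proof.
pose name (y : seq (sorts L)) (u : var x + var y) : nat :=
  match u with inl v => (var_index v).*2 | inr w => (var_index w).*2.+1 end.
have name_inj y : injective (@name y).
  move=> [v|v] [w|w] /= e; try by have := congr1 odd e; rewrite /= !odd_double.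
    by rewrite (var_index_inj (double_inj e)).
  by case: e => /double_inj/var_index_inj ->.
apply: (@small_inj _ _ _ (fun phi => (yctx phi, fo_code (@name _) (fml phi)))).
  by move=> [y p] [y' p'] [/= yy']; rewrite -{y'}yy' in p' * => /fo_code_inj ->.
by apply: small_prod => //; [exact: small_seq|exact: small_labels].
Qed.

End SmallSyntax.

(** * Substitution *)

Section Substitution.
Variables (L : signature) (M : structure L).

Lemma teval_subst (V W : Type) (sV : V -> sorts L) (sW : W -> sorts L)
    (f : forall v, term sW (sV v)) (e : asg M sW) s (t : term sV s) :
  teval e (tsubst f t) = teval (fun v => teval e (f v)) t.
Proof.
elim: t => [//|g a IH] /=; congr fint.
by apply: functional_extensionality_dep => v; exact: IH.
Qed.

Lemma teval_weaken (V : Type) (sV : V -> sorts L) (e : asg M sV) r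
    (a : carrier M r) s (t : term sV s) :
  teval (ext_asg e a) (weaken r t) = teval e t.
Proof. by rewrite /weaken teval_subst. Qed.

Lemma sat_subst (V : Type) (sV : V -> sorts L) (phi : fo_formula sV)
    (W : Type) (sW : W -> sorts L) (f : forall v, term sW (sV v)) (e : asg M sW) :
  sat (fsubst phi f) e = sat phi (fun v => teval e (f v)).
Proof.
elim: phi W sW f e =>
    {V sV} [V sV|V sV s t u|V sV r a|V sV p IHp|V sV p IHp q IHq|V sV s p IHp]
    W sW f e //=.
- by rewrite !teval_subst.
- by congr rint; apply: functional_extensionality_dep => v; exact: teval_subst.
- by rewrite IHp.
- by rewrite IHp IHq.
- congr ex; apply/funext => a; rewrite IHp; congr sat.
  apply: functional_extensionality_dep => -[v|//] /=.
  exact: teval_weaken.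
Qed.

Lemma teval_lvar (y z : seq (sorts L)) (b : pt M y) (c : pt M z) (v : var y) :
  teval (cat_pt b c) (lvar z v) = b v.
Proof.
elim: y b v => [|s y IH] b // [v|//] /=.
by rewrite (teval_weaken (sV := @vsort _ (y ++ z))) IH.
Qed.

Lemma teval_rvar (y z : seq (sorts L)) (b : pt M y) (c : pt M z) (w : var z) :
  teval (cat_pt b c) (rvar y w) = c w.
Proof.
elim: y b => [//|s y IH] b /=.
by rewrite (teval_weaken (sV := @vsort _ (y ++ z))) IH.
Qed.

Lemma inst_or_xform (x : seq (sorts L)) (phi1 phi2 : xform x)
    (b1 : pt M (yctx phi1)) (b2 : pt M (yctx phi2)) :
  @inst L M x (or_xform phi1 phi2) (cat_pt b1 b2) = inst b1 `|` inst b2.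
Proof.
apply/funext => a; rewrite /inst /= !sat_subst; congr or; congr sat;
  apply: functional_extensionality_dep => -[//|w] /=; rewrite teval_subst.
  exact: teval_lvar.
exact: teval_rvar.
Qed.

Lemma in_params_cat (A : set (elem M)) (y z : seq (sorts L)) (b : pt M y)
    (c : pt M z) :
  in_params A b -> in_params A c -> in_params A (cat_pt b c).
Proof.
elim: y b => [//|s y IH] b Ab Ac [v|] /=; last exact: (Ab None).
by apply: (IH (fun v => b (Some v))) => // w; exact: (Ab (Some w)).
Qed.

End Substitution.

(** * Definable sets *)

Section Definability.
Variables (L : signature) (M : structure L) (A : set (elem M)).

Definition pt0 : pt M [::] := fun v => match v with end.

Lemma definable_formula (V : Type) (sV : V -> sorts L) (phi : fo_formula sV) :
  definable A [set e : asg M sV | sat phi e].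
Proof.
have A0 : in_params A pt0 by case.
exists (PForm (fsubst phi (fun v => @TVar _ _ (sumsort sV (@vsort _ [::])) (inl v))) A0).
by apply/funext => e; rewrite /psat /= sat_subst.
Qed.

Lemma definable_not (V : Type) (sV : V -> sorts L) (D : set (asg M sV)) :
  definable A D -> definable A [set e | ~ D e].
Proof. by case=> psi ->; exists (pneg psi). Qed.

(** Reassembling the variables of [D] from terms in those of [sV]: renaming,
    identifying or forgetting variables are all of this form. *)
Lemma definable_comp (V W : Type) (sV : V -> sorts L) (sW : W -> sorts L)
    (g : asg M sV -> asg M sW) (h : forall w, term sV (sW w)) (D : set (asg M sW)) :
  (forall e w, teval e (h w) = g e w) ->
  definable A D -> definable A [set e | D (g e)].
Proof.
move=> hg [psi ->].
pose sVP := sumsort sV (@vsort _ (pctx psi)).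
pose f u : term sVP (sumsort sW (@vsort _ (pctx psi)) u) :=
  match u with
  | inl w => tsubst (fun v => @TVar _ _ sVP (inl v)) (h w)
  | inr p => @TVar _ _ sVP (inr p)
  end.
exists (PForm (fsubst (pfml psi) f) (@ppar_in _ _ _ _ _ psi)).
apply/funext => e; rewrite /psat /= sat_subst; congr sat.
by apply: functional_extensionality_dep => -[w|//] /=; rewrite teval_subst -hg.
Qed.

Lemma definable_or (V : Type) (sV : V -> sorts L) (D D' : set (asg M sV)) :
  definable A D -> definable A D' -> definable A [set e | D e \/ D' e].
Proof.
case=> psi -> [psi' ->].
pose s2 := sumsort sV (@vsort _ (pctx psi ++ pctx psi')).
pose par s (t : term (@vsort _ (pctx psi ++ pctx psi')) s) : term s2 s :=
  tsubst (fun v => @TVar _ _ s2 (inr v)) t.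
pose f1 u : term s2 (sumsort sV (@vsort _ (pctx psi)) u) :=
  match u with
  | inl v => @TVar _ _ s2 (inl v) | inr w => par _ (lvar (pctx psi') w)
  end.
pose f2 u : term s2 (sumsort sV (@vsort _ (pctx psi')) u) :=
  match u with
  | inl v => @TVar _ _ s2 (inl v) | inr w => par _ (rvar (pctx psi) w)
  end.
exists (PForm (FOr (fsubst (pfml psi) f1) (fsubst (pfml psi') f2))
  (in_params_cat (@ppar_in _ _ _ _ _ psi) (@ppar_in _ _ _ _ _ psi'))).
apply/funext => e; rewrite /psat /= !sat_subst; congr or; congr sat;
  apply: functional_extensionality_dep => -[//|w] /=; rewrite /par teval_subst.
  by rewrite -[LHS](teval_lvar _ (ppar psi')).
by rewrite -[LHS](teval_rvar (ppar psi)).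
Qed.

Lemma definable_and (V : Type) (sV : V -> sorts L) (D D' : set (asg M sV)) :
  definable A D -> definable A D' -> definable A [set e | D e /\ D' e].
Proof.
move=> dD dD'.
have := definable_not (definable_or (definable_not dD) (definable_not dD')).
by congr definable; apply/funext => e; rewrite /= not_orE !notK.
Qed.

Lemma definable_ex1 (V : Type) (sV : V -> sorts L) s (D : set (asg M (ext sV s))) :
  definable A D -> definable A [set e | exists a, D (ext_asg e a)].
Proof.
case=> psi ->.
pose s2 := ext (sumsort sV (@vsort _ (pctx psi))) s.
pose f u : term s2 (sumsort (ext sV s) (@vsort _ (pctx psi)) u) :=
  match u with
  | inl (Some v) => @TVar _ _ s2 (Some (inl v))
  | inl None => @TVar _ _ s2 None
  | inr w => @TVar _ _ s2 (Some (inr w))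
  end.
exists (PForm (FEx (fsubst (pfml psi) f)) (@ppar_in _ _ _ _ _ psi)).
apply/funext => e; rewrite /psat /=; congr ex; apply/funext => a.
by rewrite sat_subst; congr sat; apply: functional_extensionality_dep => -[[v|]|w].
Qed.

Lemma definable_ex (V : Type) (sV : V -> sorts L) (z : seq (sorts L))
    (D : set (asg M (sumsort sV (@vsort _ z)))) :
  definable A D -> definable A [set e | exists b : pt M z, D (join e b)].
Proof.
elim: z V sV D => [|s z IH] V sV D dD.
  have := @definable_comp V _ sV _ (fun e => join e pt0)
    (fun u => match u return term sV (sumsort sV (@vsort _ [::]) u) with
              | inl v => TVar v | inr w => match w with end end) D.
  move=> /(_ _ dD) d; have {d} : definable A [set e : asg M sV | D (join e pt0)].
    by apply: d => e [v|[]].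
  congr definable; apply/funext => e /=; apply/propext; split=> [De|[b]].
    by exists pt0.
  by congr D; apply: functional_extensionality_dep => -[v|[]].
pose g (e : asg M (sumsort (ext sV s) (@vsort _ z))) :
    asg M (sumsort sV (@vsort _ (s :: z))) :=
  join (fun v => left_part e (Some v)) (ext_asg (right_part e) (left_part e None)).
pose sz := sumsort (ext sV s) (@vsort _ z).
pose h u : term sz (sumsort sV (@vsort _ (s :: z)) u) :=
  match u with
  | inl v => @TVar _ _ sz (inl (Some v))
  | inr (Some w) => @TVar _ _ sz (inr w)
  | inr None => @TVar _ _ sz (inl None)
  end.
have dg : definable A [set e | D (g e)].
  by apply: (@definable_comp _ _ _ _ g h) dD => e [v|[w|]].
have := definable_ex1 (IH _ _ _ dg); congr definable.
apply/funext => e /=; apply/propext; split=> [[a [b Db]]|[b Db]].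
  by exists (@ext_asg _ _ _ (@vsort _ z) b s a).
exists (b None), (fun w => b (Some w)); move: Db; congr D.
by apply: functional_extensionality_dep => -[v|[w|]].
Qed.

Lemma definable_all (V : Type) (sV : V -> sorts L) (z : seq (sorts L))
    (D : set (asg M (sumsort sV (@vsort _ z)))) :
  definable A D -> definable A [set e | forall b : pt M z, D (join e b)].
Proof.
move=> /definable_not/definable_ex/definable_not; congr definable.
apply/funext => e /=; apply/propext; split=> [nD b|nD [b]]; last exact.
by apply: contrapT => Db; apply: nD; exists b.
Qed.

(** A condition on the truth values of finitely many definable conditions is a
    finite disjunction over the admissible patterns of truth values, whatever
    the condition [Q] on the patterns is; this is how real inequalities between
    averages become first-order. *)
Lemma definable_pattern (V : Type) (sV : V -> sorts L) (I : finType)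
    (D : I -> set (asg M sV)) (Q : (I -> Prop) -> Prop) :
  (forall i, definable A (D i)) -> definable A [set e | Q (fun i => D i e)].
Proof.
move=> dD.
have dall (s : seq I) (S : I -> bool) :
    definable A [set e | forall i, i \in s -> D i e <-> S i].
  elim: s => [|i s IH].
    have := definable_not (definable_formula (@FFalse _ _ sV)).
    by congr definable; apply/funext => e; apply/propext; split=> [_ i|_ []].
  have dS : definable A [set e | D i e <-> S i].
    case: (S i).
      have := dD i; congr definable.
      by apply/funext => e; apply/propext; split=> [|[]]; auto.
    have := definable_not (dD i); congr definable.
    by apply/funext => e /=; apply/propext; split=> [//|[]]; auto.
  have := definable_and dS IH; congr definable.
  apply/funext => e /=; apply/propext; split=> [[Di Ds] j|Ds].
    by rewrite inE => /predU1P[->|/Ds].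
  by split=> [|j js]; apply: Ds; rewrite inE ?eqxx ?js ?orbT.
have dex (s : seq {ffun I -> bool}) : definable A
    [set e | exists2 S : {ffun I -> bool},
       S \in s & Q (fun i => S i) /\ forall i, D i e <-> S i].
  elim: s => [|S s IH].
    have := definable_formula (@FFalse _ _ sV).
    by congr definable; apply/funext => e /=; apply/propext; split=> [|[]].
  have dS : definable A [set e | Q (fun i => S i) /\ forall i, D i e <-> S i].
    have [QS|nQS] := pselect (Q (fun i => S i)).
      have := dall (enum I) S; congr definable; apply/funext => e /=.
      apply/propext; split=> [Ds|[_ Ds] i _ //].
      by split=> // i; apply: Ds; rewrite mem_enum.
    have := definable_formula (@FFalse _ _ sV).
    by congr definable; apply/funext => e /=; apply/propext; split=> [|[]].
  have := definable_or dS IH; congr definable.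
  apply/funext => e /=; apply/propext; split=> [[|[S' ? ?]]|[S']].
  - by exists S; rewrite // inE eqxx.
  - by exists S' => //; rewrite inE orbC; apply/orP; left.
  - by rewrite inE => /predU1P[->|]; [left|right; exists S'].
have := dex (enum {ffun I -> bool}); congr definable.
apply/funext => e /=; apply/propext; split=> [[S _ [QS DS]]|QD].
  suff -> : (fun i => D i e) = (fun i => S i : Prop) by [].
  by apply/funext => i; apply/propext.
exists [ffun i => `[< D i e >]]; first by rewrite mem_enum.
split; last by move=> i; rewrite ffunE; split=> /asboolP.
move: QD; congr Q; apply/funext => i.
by rewrite ffunE; apply/propext; split=> /asboolP.
Qed.

Lemma definable_imply (V : Type) (sV : V -> sorts L) (D D' : set (asg M sV)) :
  definable A D -> definable A D' -> definable A [set e | D e -> D' e].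
Proof.
move=> /definable_not dD dD'; have := definable_or dD dD'; congr definable.
by apply/funext => e /=; rewrite implyE.
Qed.

Lemma definable_xform (x z : seq (sorts L))
    (D : set (asg M (sumsort (@vsort _ x) (@vsort _ z)))) :
  definable A D ->
  exists (theta : xform x) (g : pt M z -> pt M (yctx theta)),
    forall b, inst (g b) = [set a | D (join a b)].
Proof.
case=> psi ->.
pose s2 := sumsort (@vsort _ x) (@vsort _ (z ++ pctx psi)).
pose par s (t : term (@vsort _ (z ++ pctx psi)) s) : term s2 s :=
  tsubst (fun v => @TVar _ _ s2 (inr v)) t.
pose f u : term s2 (sumsort (sumsort (@vsort _ x) (@vsort _ z))
                      (@vsort _ (pctx psi)) u) :=
  match u with
  | inl (inl v) => @TVar _ _ s2 (inl v)
  | inl (inr w) => par _ (lvar (pctx psi) w)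
  | inr p => par _ (rvar z p)
  end.
exists (XForm (fsubst (pfml psi) f)), (fun b => cat_pt b (ppar psi)) => b.
apply/funext => a; rewrite /inst /psat /= sat_subst; congr sat.
apply: functional_extensionality_dep => -[[//|w]|p] /=; rewrite /par teval_subst.
  exact: teval_lvar.
exact: teval_rvar.
Qed.

Lemma definable_instP (x : seq (sorts L)) (D : set (pt M x)) :
  definable A D -> exists (phi : xform x) (b : pt M (yctx phi)), D = inst b.
Proof. by case=> psi ->; exists (XForm (pfml psi)), (ppar psi). Qed.

Lemma type_definable_bigcap (K I : Type) (V : Type) (sV : V -> sorts L)
    (D : I -> set (asg M sV)) :
  smallT K I -> (forall i, definable A (D i)) ->
  type_definable K A [set e | forall i, D i e].
Proof.
move=> sI /choice[psi psiD]; exists (range psi); split; first exact: small_range.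
apply/funext => e; apply/propext; split=> [De _ [i _ <-]|De i].
  by have := De i; rewrite psiD.
by rewrite psiD; apply: De; exists i.
Qed.

Lemma type_definable_and (K : Type) (V : Type) (sV : V -> sorts L)
    (X X' : set (asg M sV)) :
  strong_limit K -> type_definable K A X -> type_definable K A X' ->
  type_definable K A [set e | X e /\ X' e].
Proof.
move=> K_lim [P [sP ->]] [P' [sP' ->]].
pose D (i : {p | P p} + {p | P' p}) : set (asg M sV) :=
  [set e | match i with inl p => psat (sval p) e | inr p => psat (sval p) e end].
have dD i : definable A (D i) by case: i => -[p Pp]; exists p.
have sI : smallT K ({p | P p} + {p | P' p})%type.
  by apply: small_sum => //; exact: small_sig.
have := type_definable_bigcap sI dD; congr type_definable.
apply/funext => e; apply/propext; split=> [De|[Pe P'e] [[p Pp]|[p Pp]]].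
- by split=> p Pp; [exact: (De (inl (exist _ p Pp)))|exact: (De (inr (exist _ p Pp)))].
- exact: Pe.
- exact: P'e.
Qed.

Lemma type_definable_comp (K V W : Type) (sV : V -> sorts L) (sW : W -> sorts L)
    (g : asg M sV -> asg M sW) (h : forall w, term sV (sW w)) (X : set (asg M sW)) :
  (forall e w, teval e (h w) = g e w) ->
  type_definable K A X -> type_definable K A [set e | X (g e)].
Proof.
move=> hg [P [sP ->]].
have dP (i : {p | P p}) : definable A [set e | psat (sval i) (g e)].
  by apply: definable_comp hg _; exists (sval i).
have := type_definable_bigcap (small_sig sP) dP; congr type_definable.
apply/funext => e; apply/propext; split=> [De p Pp|Pe [p Pp]]; last exact: Pe.
exact: (De (exist _ p Pp)).
Qed.

Lemma definable_inst_terms (V : Type) (sV : V -> sorts L) (x : seq (sorts L))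
    (phi : xform x) (hx : forall v : var x, term sV (vsort v))
    (hy : forall w : var (yctx phi), term sV (vsort w)) :
  definable A [set e : asg M sV |
    inst (fun w => teval e (hy w)) (fun v => teval e (hx v))].
Proof.
pose h u : term sV (sumsort (@vsort _ x) (@vsort _ (yctx phi)) u) :=
  match u with inl v => hx v | inr w => hy w end.
have := definable_formula (fml phi).
by apply: (@definable_comp _ _ _ _ (fun e => join _ _) h) => e [].
Qed.

End Definability.

Lemma definable_inst (L : signature) (M : structure L) (x : seq (sorts L))
    (phi : xform x) (b : pt M (yctx phi)) : definable setT (inst b).
Proof.
have bT : in_params setT b by [].
by exists (PForm (fml phi) bT).
Qed.

(** * Small elementary submodels *)

Section SkolemHull.
Variables (L : signature) (M : structure L).

Lemma witness_ex s (P : set (carrier M s)) :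
  exists a, (exists b, P b) -> P a.
Proof.
have [[b Pb]|nP] := pselect (exists b, P b); first by exists b.
by have [a] := carrier_inh M s; exists a => /nP.
Qed.

Definition witness s (P : set (carrier M s)) : carrier M s :=
  projT1 (cid (witness_ex P)).

Lemma witnessP s (P : set (carrier M s)) : (exists b, P b) -> P (witness P).
Proof. exact: projT2 (cid (witness_ex P)). Qed.

(** One function symbol for each existential formula.  The Skolem hull then
    consists of the values of terms, so that counting it amounts to counting
    terms. *)
Definition skolem_sig : signature :=
  @Signature (sorts L)
    {z : seq (sorts L) & {s : sorts L & fo_formula (ext (@vsort _ z) s)}}
    (fun g => projT1 g) (fun g => projT1 (projT2 g))
    void (fun r => match r with end).

Definition skolem_str : structure skolem_sig :=
  @Structure skolem_sig (carrier M) (@carrier_inh L M)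
    (fun g c => witness (fun a => sat (projT2 (projT2 g)) (ext_asg c a)))
    (fun r => match r with end).

Variable A : set (elem M).

Definition gen_sort (p : {p | A p}) : sorts skolem_sig := projT1 (sval p).

Definition gen_asg : asg skolem_str gen_sort := fun p => projT2 (sval p).

Definition in_hull s (a : carrier M s) : Prop :=
  exists t : term gen_sort s, teval gen_asg t = a.

Definition hull : set (elem M) := [set p | in_hull (projT2 p)].

Lemma sub_hull : A `<=` hull.
Proof.
move=> p Ap.
by exists (@TVar skolem_sig _ gen_sort (exist A p Ap)).
Qed.

Lemma hull_witness (z : seq (sorts L)) s (phi : fo_formula (ext (@vsort _ z) s))
    (c : pt M z) :
  (forall v, in_hull (c v)) -> (exists a, sat phi (ext_asg c a)) ->
  exists a, in_hull a /\ sat phi (ext_asg c a).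
Proof.
move=> c_hull phi_c.
pose P a := sat phi (ext_asg c a).
exists (witness P); split; last exact: (@witnessP _ P).
pose t (v : var z) : term gen_sort (vsort v) := projT1 (cid (c_hull v)).
have tE v : teval gen_asg (t v) = c v by rewrite /t; case: cid.
exists (@TApp skolem_sig _ gen_sort (existT _ z (existT _ s phi)) t) => /=.
congr witness; apply/funext => a; congr (sat _ (ext_asg _ _)).
exact: functional_extensionality_dep.
Qed.

Lemma hull_fint (g : fsym L) (c : pt M (fdom g)) :
  (forall v, in_hull (c v)) -> in_hull (fint c).
Proof.
move=> c_hull; pose sV := ext (@vsort _ (fdom g)) (fcod g).
have [||a [a_hull /= ca]] := @hull_witness (fdom g) (fcod g)
    (FEq (TApp (fun v => @TVar _ _ sV (Some v))) (@TVar _ _ sV None)) c.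
- exact: c_hull.
- by exists (fint c).
- by move: a_hull; rewrite -ca.
Qed.

Lemma hull_inh s : inhabited {a : carrier M s | in_hull a}.
Proof.
have [//||a [a_hull _]] := @hull_witness [::] s (FNot FFalse) (@pt0 L M).
  by have [a] := carrier_inh M s; exists a => -[].
by split; exists a.
Qed.

Definition hull_str : structure L :=
  @Structure L (fun s => {a : carrier M s | in_hull a}) hull_inh
    (fun g c => exist _ _ (hull_fint (fun v => svalP (c v))))
    (fun r c => rint (fun v => sval (c v))).

Definition hull_incl s (a : carrier hull_str s) : carrier M s := sval a.

Lemma teval_hull (V : Type) (sV : V -> sorts L) (e : asg hull_str sV) s
    (t : term sV s) :
  hull_incl (teval e t) = teval (map_asg hull_incl e) t.
Proof.
elim: t => [//|g a IH] /=; rewrite /hull_incl /=; congr fint.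
by apply: functional_extensionality_dep => v; exact: IH.
Qed.

(** The Tarski-Vaught test.  Quantifiers lead out of the contexts [var z], while
    witnesses are available for formulas in such contexts; hence the terms [h],
    which interpret the variables of [phi] in a context [z] growing along with
    those of [phi]. *)
Lemma sat_hull (V : Type) (sV : V -> sorts L) (phi : fo_formula sV)
    (z : seq (sorts L)) (h : forall v, term (@vsort _ z) (sV v))
    (c : pt hull_str z) :
  sat phi (fun v => teval c (h v)) =
  sat phi (fun v => teval (map_asg hull_incl c) (h v)).
Proof.
have incl_inj s : injective (@hull_incl s).
  by move=> [a a_hull] [b b_hull] /= ab; exact: eq_exist.
elim: phi z h c =>
    {V sV} [V sV|V sV s t u|V sV r a|V sV p IHp|V sV p IHp q IHq|V sV s p IHp]
    z h c //=.
- rewrite -!(teval_subst h) -!teval_hull; apply/propext.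
  by split=> [->//|/incl_inj].
- congr rint; apply: functional_extensionality_dep => v.
  by rewrite -!(teval_subst h) -teval_hull.
- by rewrite IHp.
- by rewrite IHp IHq.
have step (a : carrier hull_str s) :
    sat p (ext_asg (fun v => teval c (h v)) a) =
    sat p (ext_asg (fun v => teval (map_asg hull_incl c) (h v)) (hull_incl a)).
  transitivity (sat p (fun o =>
      teval (@ext_asg _ _ _ (@vsort _ z) c s a) (upsubst s h o))).
    congr sat; apply: functional_extensionality_dep => -[v|//] /=.
    by rewrite teval_weaken.
  rewrite (IHp (s :: z)); congr sat.
  have -> : map_asg hull_incl (@ext_asg _ _ _ (@vsort _ z) c s a) =
      ext_asg (map_asg hull_incl c) (hull_incl a).
    by apply: functional_extensionality_dep => -[w|].
  apply: functional_extensionality_dep => -[v|//] /=.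
  exact: teval_weaken.
apply/propext; split=> [[a pa]|ex_a].
  by exists (hull_incl a); rewrite -step.
have [||a [a_hull pa]] := @hull_witness z s (fsubst p (upsubst s h))
    (map_asg hull_incl c).
- by move=> v; exact: svalP (c v).
- case: ex_a => a pa; exists a; rewrite sat_subst.
  suff -> : (fun o => teval (ext_asg (map_asg hull_incl c) a) (upsubst s h o)) =
     ext_asg (fun v => teval (map_asg hull_incl c) (h v)) a by [].
  apply: functional_extensionality_dep => -[v|//] /=.
  exact: teval_weaken.
exists (exist _ a a_hull); rewrite step; move: pa; rewrite sat_subst; congr sat.
apply: functional_extensionality_dep => -[v|//] /=.
exact: teval_weaken.
Qed.

Lemma elementary_hull : elementary_submodel hull.
Proof.
exists hull_str, hull_incl; split; first by move=> z phi c; rewrite (sat_hull _ TVar).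
apply/funext => -[s a]; apply/propext; split=> /= [a_hull|[[b b_hull] ->//]].
by exists (exist _ a a_hull).
Qed.

Variables (K : Type) (K_lim : strong_limit K).
Hypotheses (sorts_small : smallT K (sorts L)) (fsym_small : smallT K (fsym L)).
Hypotheses (rsym_small : smallT K (rsym L)) (A_small : small K A).

Lemma small_skolem_fsym : smallT K (fsym skolem_sig).
Proof.
pose code (g : fsym skolem_sig) :=
  (projT1 g, projT1 (projT2 g),
   fo_code (@var_index _ (projT1 (projT2 g) :: projT1 g)) (projT2 (projT2 g))).
apply: (@small_inj _ _ _ code); last first.
  apply: small_prod => //; last exact: small_labels.
  by apply: small_prod => //; exact: small_seq.
move=> [z [s p]] [z' [s' p']] [/= zz' ss']; rewrite -{z'}zz' -{s'}ss' in p' *.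
by move=> /(fo_code_inj (@var_index_inj _ (s :: z))) ->.
Qed.

Lemma small_hull : small K hull.
Proof.
have : smallT K {s & term gen_sort s}.
  apply: small_terms => //; [exact: small_skolem_fsym|exact: small_sig|].
  by apply: (@small_countable _ _ _ (fun r : void => 0%N)) => // -[].
move=> /(small_range (fun p => existT (carrier M) (projT1 p) (teval gen_asg (projT2 p)))).
apply: small_le; apply: subset_card_le => -[s a] [t /= ta].
by exists (existT _ s t) => //=; rewrite ta.
Qed.

End SkolemHull.

(** * Types over a small model *)

Section Types.
Variables (L : signature) (M : structure L) (B : set (elem M)).

(** By saturation every point of the type space is the type of a tuple of [M],
    so that a function on the type space may be given on tuples. *)
Lemma tp_surj (K : Type) (y : seq (sorts L)) (p : type_space B y) :
  saturated K M -> small K B -> exists b, tp B b = p.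
Proof.
move=> M_sat sB; case: p => p p_complete; have [p_fs p_or] := p_complete.
have [b pb] := M_sat B y p sB p_fs; exists b; apply: eq_exist => /=.
apply/seteqP; split=> psi //= psib.
  by have [//|/pb] := p_or psi.
exact: pb.
Qed.

Lemma nbhs_type (y : seq (sorts L)) (p : type_space B y) (psi : pform B (@vsort _ y)) :
  sval p psi -> nbhs p [set q | sval q psi].
Proof.
move=> p_psi; apply: open_nbhs_nbhs; split=> //.
exists [set [set q | sval q psi]]; last by rewrite bigcup_set1.
by move=> _ ->; apply: (@finI_from1 _ _ _ id); exists psi.
Qed.

(** Near [p], because the complement of the open condition [psi] is the open
    condition [pneg psi]. *)
Lemma near_type (y : seq (sorts L)) (p : type_space B y)
    (psi : pform B (@vsort _ y)) :
  \forall q \near p, sval q psi <-> sval p psi.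
Proof.
have clash (q : type_space B y) : sval q psi -> sval q (pneg psi) -> False.
  move=> q_psi q_npsi; have [q_fs _] := svalP q.
  have [||e e_sat] := q_fs [set psi; pneg psi]; first exact: finite_set2.
    by move=> _ [->|->].
  by apply: (e_sat (pneg psi)); [right|exact: e_sat (or_introl erefl)].
have [_ p_or] := svalP p.
have [p_psi|p_npsi] := p_or psi.
  by apply: filterS (nbhs_type p_psi) => q.
apply: filterS (nbhs_type p_npsi) => q q_npsi.
by split=> [/clash|/clash]; [case/(_ q_npsi)|case/(_ p_npsi)].
Qed.

Definition at_point (x : seq (sorts L)) (phi : xform x) (a : pt M x)
    (aB : in_params B a) : pform B (@vsort _ (yctx phi)) :=
  let s2 := sumsort (@vsort _ (yctx phi)) (@vsort _ x) in
  PForm (fsubst (fml phi) (fun u =>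
    match u return term s2 (sumsort (@vsort _ x) (@vsort _ (yctx phi)) u) with
    | inl v => @TVar _ _ s2 (inr v) | inr w => @TVar _ _ s2 (inl w)
    end)) aB.

Lemma psat_at_point (x : seq (sorts L)) (phi : xform x) (a : pt M x)
    (aB : in_params B a) (b : pt M (yctx phi)) :
  psat (at_point phi aB) b = inst b a.
Proof.
rewrite /psat sat_subst /inst /=; congr sat.
by apply: functional_extensionality_dep => -[].
Qed.

End Types.

(** * Measures approximated by averages *)

Section Averages.
Variables (R : realType).

(** An average as a function of a pattern of truth values, the form to which
    [definable_pattern] applies. *)
Definition truth_avg (m : nat) (S : 'I_m -> Prop) : R :=
  m%:R^-1 * #|[pred i | `[< S i >]]|%:R.

Lemma inv1_gt0 k : 0 < inv1 R k.
Proof. by rewrite invr_gt0 ltr0Sn. Qed.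

Lemma inv1_small (e : R) : 0 < e -> exists k, inv1 R k <= e.
Proof.
move=> e_gt0; have [k ke] : exists k, e^-1 < k%:R.
  by exists (Num.bound e^-1); rewrite archi_boundP // invr_ge0 ltW.
exists k; rewrite /inv1 invf_ple ?posrE ?ltr0Sn //.
by rewrite (le_trans (ltW ke)) // ler_nat.
Qed.

Lemma near_inv1 (e : R) : 0 < e -> \forall k \near \oo, inv1 R k <= e.
Proof.
move=> /inv1_small[k ke]; exists k => // j /= kj.
by apply: le_trans ke; rewrite lef_pV2 ?posrE ?ltr0Sn // ler_nat.
Qed.

(** The form in which limits are compared: the constant [c] collects the errors
    of several averages. *)
Lemma eq_inv1 (c r s : R) : (forall k, `|r - s| <= c * inv1 R k) -> r = s.
Proof.
move=> rs; apply/eqP; rewrite -subr_eq0 -normr_le0.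
apply/ler_addgt0Pr => e e_gt0; rewrite add0r.
have c_gt0 : 0 < Num.max c 1 by rewrite lt_max ltr01 orbT.
have [k ke] := inv1_small (divr_gt0 e_gt0 c_gt0).
apply: le_trans (rs k) _; apply: (@le_trans _ _ (Num.max c 1 * inv1 R k)).
  by apply: ler_wpM2r; [exact/ltW/inv1_gt0|rewrite le_max lexx].
by rewrite mulrC -ler_pdivlMr.
Qed.

Variables (L : signature) (M : structure L) (x : seq (sorts L)).

Lemma Av_truth m (a : 'I_m -> pt M x) (D : set (pt M x)) :
  Av R a D = truth_avg (fun i => D (a i)).
Proof. by []. Qed.

Lemma Av_ge0 m (a : 'I_m -> pt M x) (D : set (pt M x)) : 0 <= Av R a D.
Proof. by rewrite mulr_ge0 ?invr_ge0. Qed.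

Lemma Av_setT m (a : 'I_m -> pt M x) : (0 < m)%N -> Av R a setT = 1.
Proof.
move=> m_gt0; rewrite /Av (@eq_card _ _ predT) ?card_ord.
  by rewrite mulVf // pnatr_eq0 -lt0n.
by move=> i; rewrite [LHS]inE; apply/asboolP.
Qed.

Lemma Av_gt0 m (a : 'I_m -> pt M x) (D : set (pt M x)) :
  0 < Av R a D -> exists i, D (a i).
Proof.
move=> Av_gt0; have [i] : exists i, i \in [pred i | `[< D (a i) >]].
  apply/card_gt0P; rewrite lt0n; apply/eqP => D0.
  by move: Av_gt0; rewrite /Av D0 mulr0 ltxx.
by rewrite inE => Di; exists i.
Qed.

Definition approximable (mu : set (pt M x) -> R) : Prop :=
  forall (phi : xform x) (eps : R), 0 < eps ->
    exists m (a : 'I_m -> pt M x), approximation mu phi eps a.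

End Averages.

Section GenericStability.
Variables (R : realType) (K : Type) (L : signature) (M : structure L).
Hypotheses (K_lim : strong_limit K) (M_sat : saturated K M).
Hypotheses (sorts_small : smallT K (sorts L)) (fsym_small : smallT K (fsym L)).
Hypotheses (rsym_small : smallT K (rsym L)).

(** A small elementary submodel containing all the approximating points does:
    up to a uniform error the measure of an instance depends only on which of
    finitely many points of the submodel belong to it. *)
Lemma approximable_gs (x : seq (sorts L)) (mu : set (pt M x) -> R) :
  keisler_measure mu -> approximable mu -> generically_stable K mu.
Proof.
move=> mu_K mu_app; split=> //.
have /choice[F FP] : forall p : xform x * nat,
    exists s : {m & 'I_m -> pt M x}, approximation mu p.1 (inv1 R p.2) (projT2 s).
  move=> [phi k]; have [m [a a_app]] := mu_app phi _ (inv1_gt0 R k).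
  by exists (existT _ m a).
pose T0 := {p : xform x * nat & ('I_(projT1 (F p)) * var x)%type}.
pose pnt (t : T0) : elem M :=
  existT _ (vsort (projT2 t).2) (projT2 (F (projT1 t)) (projT2 t).1 (projT2 t).2).
have T0_small : smallT K T0.
  apply: (@small_inj _ _ _
    (fun t : T0 => (projT1 t, nat_of_ord (projT2 t).1, var_index (projT2 t).2))).
    move=> [p [i v]] [p' [i' v']] /= e.
    have pp' := congr1 (fun q => q.1.1) e; rewrite /= in pp'.
    rewrite -{p'}pp' in i' e *.
    have /val_inj <- := congr1 (fun q => q.1.2) e.
    by have /var_index_inj <- := congr1 (fun q => q.2) e.
  have nat_small : smallT K nat by apply: (@small_countable _ _ _ id).
  do 3 apply: small_prod => //; exact: small_xform.
exists (hull (range pnt)); set B := hull _.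
have aB phi k i : in_params B (projT2 (F (phi, k)) i).
  by move=> v; apply: sub_hull; exists (existT _ (phi, k) (i, v)).
have B_small : small K B by apply: small_hull => //; exact: small_range.
have near_eq phi k (b b' : pt M (yctx phi)) :
    (forall i, psat (at_point phi (aB phi k i)) b <->
               psat (at_point phi (aB phi k i)) b') ->
    `|mu (inst b) - mu (inst b')| <= 2 * inv1 R k.
  move=> bb'; have := FP (phi, k) b; have := FP (phi, k) b' => /=.
  suff -> : Av R (projT2 (F (phi, k))) (inst b) = Av R (projT2 (F (phi, k))) (inst b').
    by rewrite !ler_norml => /andP[? ?] /andP[? ?]; apply/andP; split; lra.
  rewrite !Av_truth; congr truth_avg; apply/funext => i; apply/propext.
  by rewrite -!psat_at_point.
have mu_inv : invariant_over B mu.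
  move=> phi b b' bb'; apply: (@eq_inv1 _ 2) => k; apply: near_eq => i.
  by have /(congr1 (fun p => sval p (at_point phi (aB phi k i)))) /= := bb' => ->.
split=> //; first exact: elementary_hull.
- split=> // phi.
  have /choice[g gP] (p : type_space B (yctx phi)) : exists b, tp B b = p.
    exact: tp_surj M_sat B_small.
  exists (fun p => mu (inst (g p))); split; last by move=> b; apply: mu_inv.
  move=> p; apply: (cvgrPdist_le (FF := nbhs_filter p) _ _).2 => e e_gt0.
  have [k ke] := inv1_small (divr_gt0 e_gt0 (ltr0Sn R 1)).
  have near_p := filter_forall (nbhs_filter p)
    (fun i => near_type p (at_point phi (aB phi k i))).
  apply: (@filterS _ _ (nbhs_filter p) _ _ _ near_p) => q qp.
  apply: le_trans (near_eq _ k _ _ _) _ => [i|].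
    by have := qp i; rewrite -{1}(gP q) -{1}(gP p) /= => ->.
  by rewrite mulrC -ler_pdivlMr.
- move=> phi b mu_b; have [k ke] := inv1_small (divr_gt0 mu_b (ltr0Sn R 1)).
  have [i ai] : exists i, inst b (projT2 (F (phi, k)) i).
    apply: (@Av_gt0 R); have := FP (phi, k) b; rewrite ler_norml => /andP[/= + _].
    by move: ke mu_b; set r := mu _; set s := inv1 _ _; set t := Av _ _ _ => *; lra.
  by exists (projT2 (F (phi, k)) i).
Qed.

End GenericStability.

(** * Codes and their measures *)

Arguments block {R L M n x} a phi k i v.

Section Codes.
Variables (R : realType) (L : signature) (M : structure L).
Variable n : forall x : seq (sorts L), xform x -> R -> nat.

Section OneContext.
Variable x : seq (sorts L).
Implicit Types (mu : set (pt M x) -> R) (a : code M n x).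

(** Convergence of the averages of [a] to [mu] with an explicit rate, which
    turns statements about limits into linear inequalities. *)
Definition coded_within (c : R) a mu : Prop :=
  forall (phi : xform x) k (b : pt M (yctx phi)),
    `|Av R (block a phi k) (inst b) - mu (inst b)| <= c * inv1 R k.

Lemma coded_within_codes (c : R) a mu : coded_within c a mu -> codes a mu.
Proof.
move=> amu phi b; apply/cvgrPdist_le => e e_gt0.
have c_gt0 : 0 < Num.max c 1 by rewrite lt_max ltr01 orbT.
apply: filterS (near_inv1 (divr_gt0 e_gt0 c_gt0)) => k ke.
rewrite distrC; apply: le_trans (amu _ _ _) _.
apply: (@le_trans _ _ (Num.max c 1 * inv1 R k)).
  by apply: ler_wpM2r; [exact/ltW/inv1_gt0|rewrite le_max lexx].
by rewrite mulrC -ler_pdivlMr.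
Qed.

(** On the set of codes the rate [2/k] is automatic: it is the limit, as [k2]
    grows, of the bound that compares the blocks [k] and [k2]. *)
Lemma coded_within_codeP a mu : code_set a -> codes a mu <-> coded_within 2 a mu.
Proof.
move=> [a_cauchy _]; split; last exact: coded_within_codes.
move=> a_mu phi k b; apply/ler_addgt0Pr => e e_gt0.
have /cvgrPdist_le/(_ _ e_gt0)[k1 _ near_mu] := a_mu phi b.
have := a_cauchy phi k k (maxn k k1) b (leqnn k) (leq_maxl k k1).
have := near_mu (maxn k k1) (leq_maxr k k1) => /=.
by rewrite !ler_norml => /andP[? ?] /andP[? ?]; apply/andP; split; lra.
Qed.

Lemma code_eqvP a a' mu mu' : code_set a -> code_set a' -> codes a mu -> codes a' mu' ->
  code_eqv a a' <->
  (forall (phi : xform x) (b : pt M (yctx phi)), mu (inst b) = mu' (inst b)).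
Proof.
move=> Xa Xa' /(coded_within_codeP _ Xa) amu /(coded_within_codeP _ Xa') amu'.
split=> [aa' phi b|mu_eq phi k b].
  (* 8 = 4 + 2 + 2: equivalence of the codes, and the rate of each of them. *)
  apply: (@eq_inv1 _ 8) => k; have := aa' phi k b.
  have := amu phi k b; have := amu' phi k b.
  rewrite !ler_norml => /andP[? ?] /andP[? ?] /andP[? ?].
  by apply/andP; split; lra.
have := amu phi k b; have := amu' phi k b; rewrite mu_eq.
by rewrite !ler_norml => /andP[? ?] /andP[? ?]; apply/andP; split; lra.
Qed.

Lemma codes_eqv a a' mu : code_set a -> code_eqv a a' -> codes a mu -> codes a' mu.
Proof.
move=> Xa aa' /(coded_within_codeP _ Xa) amu; apply: (@coded_within_codes 6).
move=> phi k b; have := aa' phi k b; have := amu phi k b.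
by rewrite !ler_norml => /andP[? ?] /andP[? ?]; apply/andP; split; lra.
Qed.

Lemma code_eqv_refl a : code_eqv a a.
Proof. by move=> phi k b; rewrite subrr normr0 mulr_ge0 // ltW // inv1_gt0. Qed.

Lemma eqv_class_codes a a' mu : code_set a -> code_set a' -> codes a mu -> codes a' mu ->
  eqv_class (@code_set R L M n x) (@code_eqv R L M n x) a =
  eqv_class (@code_set R L M n x) (@code_eqv R L M n x) a'.
Proof.
suff sub a1 a2 : code_set a1 -> code_set a2 -> codes a1 mu -> codes a2 mu ->
    eqv_class (@code_set R L M n x) (@code_eqv R L M n x) a1 `<=`
    eqv_class (@code_set R L M n x) (@code_eqv R L M n x) a2.
  by move=> Xa Xa' amu a'mu; apply/seteqP; split; apply: sub.
move=> X1 X2 a1mu a2mu a3 [X3 a13]; split=> //.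
by apply/(code_eqvP X2 X3 a2mu (codes_eqv X1 a13 a1mu)).
Qed.

(** The limit of the averages exists by (i), up to an error of [2/k] after [k]
    steps.  It depends on the definable set only, and not on the formula that
    defines it, because by (ii) it is complementary to the limit for the
    negation of any such formula. *)
Lemma code_measure a : (forall (phi : xform x) k, (0 < n phi (inv1 R k))%N) -> code_set a ->
  exists mu, keisler_measure mu /\ coded_within 2 a mu.
Proof.
move=> n_gt0 [a_cauchy a_add].
have /choice[lim0 lim0P] (p : {phi : xform x & pt M (yctx phi)}) : exists l : R,
    forall k, `|Av R (block a (projT1 p) k) (inst (projT2 p)) - l| <= 2 * inv1 R k.
  case: p => phi b /=; pose u k := Av R (block a phi k) (inst b).
  have u_cvg : cvg (u @ \oo).
    apply/cauchy_cvgP/cauchy_exP => e e_gt0.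
    have [k ke] := inv1_small (divr_gt0 e_gt0 (ltr0Sn R 2)).
    exists (u k); exists k => // j /= kj; rewrite /ball /=.
    apply: le_lt_trans (a_cauchy phi k k j b (leqnn k) kj) _.
    by have := inv1_gt0 R k; move: ke; set s := inv1 _ _ => *; lra.
  exists (lim (u @ \oo)) => k; apply/ler_addgt0Pr => e e_gt0.
  have /cvgrPdist_le/(_ _ e_gt0)[k1 _ near_l] := u_cvg.
  have := a_cauchy phi k k (maxn k k1) b (leqnn k) (leq_maxl k k1).
  have := near_l (maxn k k1) (leq_maxr k k1); rewrite /u /=.
  by rewrite !ler_norml => /andP[? ?] /andP[? ?]; apply/andP; split; lra.
pose l (phi : xform x) (b : pt M (yctx phi)) : R := lim0 (existT _ phi b).
have lP phi k (b : pt M (yctx phi)) :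
    `|Av R (block a phi k) (inst b) - l phi b| <= 2 * inv1 R k.
  exact: lim0P (existT _ phi b) k.
have l_add phi1 phi2 (b1 : pt M (yctx phi1)) (b2 : pt M (yctx phi2)) :
    inst b1 `&` inst b2 = set0 ->
    l (or_xform phi1 phi2) (cat_pt b1 b2) = l phi1 b1 + l phi2 b2.
  (* 9 = 3 + 2 + 2 + 2: condition (ii), and the rates of the three limits. *)
  move=> b12; apply: (@eq_inv1 _ 9) => k; have := a_add _ _ k _ _ b12.
  have := lP phi1 k b1; have := lP phi2 k b2.
  have := lP (or_xform phi1 phi2) k (cat_pt b1 b2).
  rewrite !ler_norml => /andP[? ?] /andP[? ?] /andP[? ?] /andP[? ?].
  by apply/andP; split; lra.
have l_setT phi (b : pt M (yctx phi)) : inst b = setT -> l phi b = 1.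
  move=> bT; apply: (@eq_inv1 _ 2) => k; rewrite distrC.
  by have := lP phi k b; rewrite bT Av_setT.
pose neg (phi : xform x) : xform x := XForm (FNot (fml phi)).
have l_neg phi (b : pt M (yctx phi)) phi' (b' : pt M (yctx phi')) :
    inst b = inst b' -> l phi' b' + l (neg phi) b = 1.
  move=> bb'; have bC : @inst L M x (neg phi) b = ~` inst b by [].
  rewrite -l_add; last by rewrite bC bb' setICr.
  by apply: l_setT; rewrite inst_or_xform bC bb' setUv.
have l_ext phi (b : pt M (yctx phi)) phi' (b' : pt M (yctx phi')) :
    inst b = inst b' -> l phi b = l phi' b'.
  move=> bb'; apply: (addIr (l (neg phi) b)).
  by rewrite (l_neg phi b phi b) // (l_neg phi b phi' b').
have /choice[mu muP] (D : set (pt M x)) : exists r : R,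
    forall (phi : xform x) (b : pt M (yctx phi)), D = inst b -> l phi b = r.
  have [[phi [b Db]]|nD] :=
    pselect (exists (phi : xform x) (b : pt M (yctx phi)), D = inst b).
    by exists (l phi b) => phi' b' Db'; apply: l_ext; rewrite -Db -Db'.
  by exists 0 => phi b Db; case: nD; exists phi, b.
have mu_inst phi (b : pt M (yctx phi)) : mu (inst b) = l phi b.
  by rewrite (muP (inst b) phi b).
exists mu; split; last by move=> phi k b; rewrite mu_inst.
split.
- move=> D /definable_instP[phi [b ->]]; rewrite mu_inst.
  apply/ler_addgt0Pl => e e_gt0.
  have [k ke] := inv1_small (divr_gt0 e_gt0 (ltr0Sn R 1)).
  have := lP phi k b; have := Av_ge0 R (block a phi k) (inst b).
  rewrite ler_norml => ? /andP[? ?].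
  by lra.
- pose top : xform x := @XForm L x [::] (FNot FFalse).
  have topT : @inst L M x top (@pt0 L M) = setT by apply/seteqP; split=> // c _ [].
  by rewrite -topT mu_inst l_setT.
- move=> D D' /definable_instP[phi [b ->]] /definable_instP[phi' [b' ->]] disj.
  by rewrite -inst_or_xform !mu_inst l_add.
Qed.

End OneContext.
End Codes.

Section CodingTheorem.
Variables (R : realType) (K : Type) (L : signature) (T : set (sentence L)).
Variables (M : structure L) (M_monster : monster_model K T M).
Variable n : forall x : seq (sorts L), xform x -> R -> nat.
Hypothesis n_approx : approximation_numbers K M n.

(** The blocks of a code are themselves the approximations that make its measure
    generically stable. *)
Lemma code_gs (x : seq (sorts L)) (a : code M n x) : code_set a ->
  exists mu, generically_stable K mu /\ codes a mu.
Proof.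
case: M_monster => K_lim ss fs rs _ M_sat _ Xa.
have n_gt0 (phi : xform x) k : (0 < n phi (inv1 R k))%N.
  by have [] := n_approx phi (inv1_gt0 R k).
have [mu [mu_K amu]] := code_measure n_gt0 Xa.
exists mu; split; last exact: coded_within_codes amu.
apply: approximable_gs => // phi eps eps_gt0.
have [k ke] := inv1_small (divr_gt0 eps_gt0 (ltr0Sn R 1)).
exists (n phi (inv1 R k)), (block a phi k) => b.
by apply: le_trans (amu _ _ _) _; rewrite mulrC -ler_pdivlMr.
Qed.

(** Approximations within [1/k] satisfy (i) with error [1/k + 1/k] and (ii) with
    error [1/k + 1/k + 1/k], the measure being additive. *)
Lemma gs_code (x : seq (sorts L)) (mu : set (pt M x) -> R) :
  generically_stable K mu -> exists a : code M n x, code_set a /\ codes a mu.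
Proof.
move=> mu_gs.
have F_ex phi k : exists F : 'I_(n phi (inv1 R k)) -> pt M x,
    approximation mu phi (inv1 R k) F.
  by have [_] := n_approx phi (inv1_gt0 R k); apply.
pose F phi k := projT1 (cid (F_ex phi k)).
pose a : code M n x := fun v => F (cv_form v) (cv_k v) (cv_i v) (cv_v v).
have aP phi k (b : pt M (yctx phi)) :
    `|Av R (block a phi k) (inst b) - mu (inst b)| <= inv1 R k.
  exact: projT2 (cid (F_ex phi k)) b.
exists a; split; last first.
  by apply: (@coded_within_codes _ _ _ _ _ 1) => phi k b; rewrite mul1r.
split=> [phi k k1 k2 b kk1 kk2|phi1 phi2 k b1 b2 disj].
  have inv1_le j : (k <= j)%N -> inv1 R j <= inv1 R k.
    by move=> kj; rewrite lef_pV2 ?posrE ?ltr0Sn // ler_nat.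
  have := inv1_le _ kk1; have := inv1_le _ kk2.
  have := aP phi k1 b; have := aP phi k2 b.
  rewrite !ler_norml => /andP[? ?] /andP[? ?] ? ?; apply/andP; split; lra.
have := aP phi1 k b1; have := aP phi2 k b2.
have := aP (or_xform phi1 phi2) k (cat_pt b1 b2).
have [[_ _ mu_add] _] := mu_gs.
have -> : mu (@inst L M x (or_xform phi1 phi2) (cat_pt b1 b2)) =
    mu (inst b1) + mu (inst b2).
  by rewrite inst_or_xform mu_add //; exact: definable_inst.
rewrite !ler_norml => /andP[? ?] /andP[? ?] /andP[? ?].
by apply/andP; split; lra.
Qed.

Variables (x y : seq (sorts L)) (A : set (elem M)) (f : pt M x -> pt M y).
Hypothesis f_def : definable_map A f.

Lemma definable_inst_image (psi : xform y) :
  definable A [set e : asg M (sumsort (@vsort _ x) (@vsort _ (yctx psi))) |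
    inst (right_part e) (f (left_part e))].
Proof.
pose sV := sumsort (sumsort (@vsort _ x) (@vsort _ (yctx psi))) (@vsort _ y).
have d1 : definable A [set e : asg M sV |
    f (left_part (left_part e)) = right_part e].
  have := f_def; apply: (@definable_comp _ _ _ _ _ _ _
    (fun e : asg M sV => join (left_part (left_part e)) (right_part e))
    (fun u => match u return term sV (sumsort (@vsort _ x) (@vsort _ y) u) with
              | inl v => @TVar _ _ sV (inl (inl v))
              | inr w => @TVar _ _ sV (inr w)
              end)).
  by move=> e [].
have d2 := @definable_inst_terms L M A _ sV y psi
  (fun v => @TVar _ _ sV (inr v)) (fun w => @TVar _ _ sV (inl (inr w))).
have := definable_ex (definable_and d1 d2); congr definable.
apply/funext => e; apply/propext; split=> [[c [/= fc psi_c]]|psi_e].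
  by have {}fc : f (left_part e) = c by []; rewrite /= fc.
by exists (f (left_part e)).
Qed.

(** The parameters of [f] become part of the parameters [g b] of the instance,
    so that [theta] is a formula without parameters, as codes require. *)
Lemma pullback_xform (psi : xform y) :
  exists (theta : xform x) (g : pt M (yctx psi) -> pt M (yctx theta)),
    forall b, inst (g b) = f @^-1` inst b.
Proof. exact: definable_xform (definable_inst_image psi). Qed.

(** The average of the points [f (a i)] over a set is the average of the points
    [a i] over its preimage. *)
Lemma pushforward_gs (mu : set (pt M x) -> R) :
  generically_stable K mu -> generically_stable K (pushforward f mu).
Proof.
case: M_monster => K_lim ss fs rs _ M_sat _ mu_gs.
have [[mu_ge0 mu1 mu_add] _] := mu_gs.
have preim_def D : definable setT D -> definable setT (f @^-1` D).
  move=> /definable_instP[psi [b ->]].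
  have [theta [g gP]] := pullback_xform psi; rewrite -gP.
  exact: definable_inst.
apply: approximable_gs => //.
  split=> [D dD|//|D D' dD dD' DD']; first by apply: mu_ge0; exact: preim_def.
  rewrite /pushforward preimage_setU mu_add //; try exact: preim_def.
  by rewrite -preimage_setI DD' preimage_set0.
move=> psi eps eps_gt0; have [theta [g gP]] := pullback_xform psi.
have [_ /(_ _ mu_gs)[a a_app]] := n_approx theta eps_gt0.
by exists (n theta eps), (f \o a) => b; have := a_app (g b); rewrite gP.
Qed.

End CodingTheorem.

(** * Type-definability *)

Section TypeDefinability.
Variables (R : realType) (K : Type) (L : signature) (M : structure L).
Variable n : forall x : seq (sorts L), xform x -> R -> nat.
Hypotheses (K_lim : strong_limit K) (sorts_small : smallT K (sorts L)).
Hypotheses (fsym_small : smallT K (fsym L)) (rsym_small : smallT K (rsym L)).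
Variable A : set (elem M).

Lemma type_definable_code_set (x : seq (sorts L)) :
  type_definable K A (@code_set R L M n x).
Proof.
have nat_small : smallT K nat by apply: (@small_countable _ _ _ id).
have xform_small : smallT K (xform x) by exact: small_xform.
apply: (@type_definable_and _ _ A K _ _ [set a : code M n x | _] [set a | _]) => //.
- have sI : smallT K (xform x * nat * nat * nat)%type by do 3 apply: small_prod => //.
  pose D (i : xform x * nat * nat * nat) := [set a : code M n x |
    (i.1.1.2 <= i.1.2)%N -> (i.1.1.2 <= i.2)%N ->
    forall b : pt M (yctx i.1.1.1),
    `|Av R (block a i.1.1.1 i.1.2) (inst b) - Av R (block a i.1.1.1 i.2) (inst b)|
      <= 2 * inv1 R i.1.1.2].
  have dD i : definable A (D i).
    case: i => [[[phi k] k1] k2]; rewrite /D /=.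
    have imp (P : Prop) (X : set (code M n x)) :
        definable A X -> definable A [set a | P -> X a].
      move=> dX; have := definable_pattern (fun S => P -> S tt) (fun=> dX).
      exact.
    do 2 apply: (imp _ _).
    pose sV := sumsort (@code_sort R L n x) (@vsort _ (yctx phi)).
    pose E (i : 'I_(n phi (inv1 R k1)) + 'I_(n phi (inv1 R k2))) := [set e : asg M sV |
      inst (right_part e) match i with
                          | inl i1 => block (left_part e) phi k1 i1
                          | inr i2 => block (left_part e) phi k2 i2
                          end].
    have dE i : definable A (E i).
      by case: i => i;
        have := @definable_inst_terms L M A _ sV x phi
          (fun v => @TVar _ _ sV (inl (CodeVar i v))) (fun w => @TVar _ _ sV (inr w)).
    exact: definable_all (definable_pattern (fun S =>
      `|truth_avg R (fun i => S (inl i)) - truth_avg R (fun i => S (inr i))|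
         <= 2 * inv1 R k) dE).
  have := type_definable_bigcap sI dD; congr type_definable.
  apply/funext => a; apply/propext; split=> Da.
    by move=> phi k k1 k2 b h1 h2; exact: (Da (phi, k, k1, k2)).
  by move=> [[[phi k] k1] k2] h1 h2 b; exact: Da.
have sI : smallT K (xform x * xform x * nat)%type by do 2 apply: small_prod => //.
pose D (i : xform x * xform x * nat) := [set a : code M n x |
  forall (b1 : pt M (yctx i.1.1)) (b2 : pt M (yctx i.1.2)),
    ~ (exists c, inst b1 c /\ inst b2 c) ->
    `|Av R (block a (or_xform i.1.1 i.1.2) i.2) (inst b1 `|` inst b2)
       - (Av R (block a i.1.1 i.2) (inst b1) + Av R (block a i.1.2 i.2) (inst b2))|
    <= 3 * inv1 R i.2].
have dD i : definable A (D i).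
  case: i => [[phi1 phi2] k]; rewrite /D /=.
  pose sV := sumsort (sumsort (@code_sort R L n x) (@vsort _ (yctx phi1)))
                     (@vsort _ (yctx phi2)).
  have dinst1 phi j (i : 'I_(n phi (inv1 R j))) : definable A [set e : asg M sV |
      inst (right_part (left_part e)) (block (left_part (left_part e)) phi j i)].
    exact: (@definable_inst_terms L M A _ sV x phi1
      (fun v => @TVar _ _ sV (inl (inl (CodeVar i v))))
      (fun w => @TVar _ _ sV (inl (inr w)))).
  have dinst2 phi j (i : 'I_(n phi (inv1 R j))) : definable A [set e : asg M sV |
      inst (right_part e) (block (left_part (left_part e)) phi j i)].
    exact: (@definable_inst_terms L M A _ sV x phi2
      (fun v => @TVar _ _ sV (inl (inl (CodeVar i v))))
      (fun w => @TVar _ _ sV (inr w))).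
  have ddisj : definable A [set e : asg M sV |
      ~ exists c, inst (right_part (left_part e)) c /\ inst (right_part e) c].
    pose sW := sumsort sV (@vsort _ x).
    have d1 := @definable_inst_terms L M A _ sW x phi1
      (fun v => @TVar _ _ sW (inr v)) (fun w => @TVar _ _ sW (inl (inl (inr w)))).
    have d2 := @definable_inst_terms L M A _ sW x phi2
      (fun v => @TVar _ _ sW (inr v)) (fun w => @TVar _ _ sW (inl (inr w))).
    exact: definable_not (definable_ex (definable_and d1 d2)).
  pose I12 := 'I_(n (or_xform phi1 phi2) (inv1 R k)).
  pose I1 := 'I_(n phi1 (inv1 R k)); pose I2 := 'I_(n phi2 (inv1 R k)).
  pose E (i : I12 + (I1 + I2)) := [set e : asg M sV |
    match i with
    | inl j => (inst (right_part (left_part e)) `|` inst (right_part e))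
                 (block (left_part (left_part e)) (or_xform phi1 phi2) k j)
    | inr (inl j) =>
        inst (right_part (left_part e)) (block (left_part (left_part e)) phi1 k j)
    | inr (inr j) =>
        inst (right_part e) (block (left_part (left_part e)) phi2 k j)
    end].
  have dE i : definable A (E i).
    case: i => [j|[j|j]]; [|exact: dinst1|exact: dinst2].
    exact: (definable_or (dinst1 _ _ j) (dinst2 _ _ j)).
  have dQ := definable_pattern (fun S => `|truth_avg R (fun j => S (inl j)) -
     (truth_avg R (fun j => S (inr (inl j))) + truth_avg R (fun j => S (inr (inr j))))|
     <= 3 * inv1 R k) dE.
  exact: definable_all (definable_all (definable_imply ddisj dQ)).
have := type_definable_bigcap sI dD; congr type_definable.
apply/funext => a; apply/propext; split=> Da.
  move=> phi1 phi2 k b1 b2 disj; rewrite inst_or_xform.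
  apply: (Da (phi1, phi2, k)) => -[c c12].
  by have : set0 c by rewrite -disj.
move=> [[phi1 phi2] k] b1 b2 disj /=; have := Da phi1 phi2 k b1 b2.
rewrite inst_or_xform; apply; apply/seteqP; split=> // c c12.
by apply: disj; exists c.
Qed.

Lemma definable_close_averages (x y : seq (sorts L)) (f : pt M x -> pt M y)
    (psi : xform y) (theta : xform x) (k : nat) :
  definable_map A f ->
  definable A [set e : asg M (sumsort (@code_sort R L n x) (@code_sort R L n y)) |
    forall b : pt M (yctx psi),
      `|Av R (block (right_part e) psi k) (inst b)
         - Av R (block (left_part e) theta k) (f @^-1` inst b)| <= 4 * inv1 R k].
Proof.
move=> f_def; pose sV := sumsort
  (sumsort (@code_sort R L n x) (@code_sort R L n y)) (@vsort _ (yctx psi)).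
pose F (i : 'I_(n psi (inv1 R k)) + 'I_(n theta (inv1 R k))) :=
  [set e : asg M sV | match i with
    | inl j => inst (right_part e) (block (right_part (left_part e)) psi k j)
    | inr j => inst (right_part e) (f (block (left_part (left_part e)) theta k j))
    end].
have dF i : definable A (F i).
  case: i => j.
    exact: (@definable_inst_terms L M A _ sV y psi
      (fun v => @TVar _ _ sV (inl (inr (CodeVar j v))))
      (fun w => @TVar _ _ sV (inr w))).
  have := definable_inst_image f_def psi.
  apply: (@definable_comp _ _ _ _ _ _ _ (fun e : asg M sV =>
      join (block (left_part (left_part e)) theta k j) (right_part e))
    (fun u => match u return
        term sV (sumsort (@vsort _ x) (@vsort _ (yctx psi)) u) with
      | inl v => @TVar _ _ sV (inl (inl (CodeVar j v)))
      | inr w => @TVar _ _ sV (inr w)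
      end)).
  by move=> e [].
exact: definable_all (definable_pattern (fun S =>
  `|truth_avg R (fun i => S (inl i)) - truth_avg R (fun i => S (inr i))|
     <= 4 * inv1 R k) dF).
Qed.

End TypeDefinability.

(** * The graph of the push-forward *)

Section PushforwardGraph.
Variables (R : realType) (K : Type) (L : signature) (T : set (sentence L)).
Variables (M : structure L) (M_monster : monster_model K T M).
Variable n : forall x : seq (sorts L), xform x -> R -> nat.
Hypothesis n_approx : approximation_numbers K M n.
Variables (x y : seq (sorts L)) (A : set (elem M)) (f : pt M x -> pt M y).
Hypothesis f_def : definable_map A f.

Local Notation X z := (@code_set R L M n z).
Local Notation E z := (@code_eqv R L M n z).
Local Notation graph := (@pushforward_graph R K L M n x y f).

Lemma class_of_code (z : seq (sorts L)) (a : code M n z) : X z a ->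
  exists C : quotient (X z) (E z), sval C = eqv_class (X z) (E z) a.
Proof.
move=> Xa; have Ca : exists2 a', X z a' &
    eqv_class (X z) (E z) a = eqv_class (X z) (E z) a' by exists a.
by exists (exist
  (fun C => exists2 a', X z a' & C = eqv_class (X z) (E z) a') _ Ca).
Qed.

Lemma pushforward_graph_total C : exists D, graph C D.
Proof.
have [a Xa CE] := svalP C.
have [mu [mu_gs amu]] := code_gs M_monster n_approx Xa.
have fmu_gs := pushforward_gs M_monster n_approx f_def mu_gs.
have [d [Xd dfmu]] := gs_code n_approx fmu_gs.
have [D DE] := class_of_code Xd.
by exists D, mu; split; split=> //; [exists a|exists d].
Qed.

(** Two measures in the class [C] agree on definable sets, though perhaps not as
    functions on all sets; preimages of definable sets being definable, their
    push-forwards agree on definable sets too, which is what codes see. *)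
Lemma pushforward_graph_unique C D D' : graph C D -> graph C D' -> D = D'.
Proof.
move=> [mu [[_ [a [Xa amu CE]]] [_ [d [Xd dfmu DE]]]]].
move=> [mu' [[_ [a' [Xa' a'mu' CE']]] [_ [d' [Xd' d'fmu' DE']]]]].
have aa' : code_eqv a a'.
  suff [] : eqv_class (X x) (E x) a a' by [].
  by rewrite -CE CE'; split=> //; exact: code_eqv_refl.
have mumu' := (code_eqvP Xa Xa' amu a'mu').1 aa'.
have d'fmu : codes d' (pushforward f mu).
  move=> psi b; have [theta [g gP]] := pullback_xform f_def psi.
  by rewrite /pushforward -gP mumu' gP; exact: d'fmu'.
have : sval D = sval D' by rewrite DE DE'; exact: eqv_class_codes dfmu d'fmu.
by case: D D' {DE DE'} => [D PD] [D' PD']; exact: eq_exist.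
Qed.

(** The averages of [d] approximate the push-forward, and those of [a], taken
    on the formula [theta psi] that pulls [psi] back along [f], approximate the
    measure of the preimage. *)
Lemma pushforward_graph_codes (theta : xform y -> xform x) (a : code M n x)
    (d : code M n y) :
  (forall psi, exists g : pt M (yctx psi) -> pt M (yctx (theta psi)),
    forall b, inst (g b) = f @^-1` inst b) ->
  (exists C D, [/\ graph C D, sval C a & sval D d]) <->
  [/\ X x a, X y d & forall (psi : xform y) k (b : pt M (yctx psi)),
     `|Av R (block d psi k) (inst b)
        - Av R (block a (theta psi) k) (f @^-1` inst b)| <= 4 * inv1 R k].
Proof.
move=> thetaP; split.
  move=> [C [D [[mu [[_ [a0 [Xa0 a0mu ->]]] [_ [d0 [Xd0 d0fmu ->]]]]]]]].
  move=> [Xa a0a] [Xd d0d]; split=> // psi k b; have [g gP] := thetaP psi.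
  have := (coded_within_codeP _ Xa).1 (codes_eqv Xa0 a0a a0mu) (theta psi) k (g b).
  have := (coded_within_codeP _ Xd).1 (codes_eqv Xd0 d0d d0fmu) psi k b.
  rewrite /pushforward -gP.
  by rewrite !ler_norml => /andP[? ?] /andP[? ?]; apply/andP; split; lra.
move=> [Xa Xd close].
have [mu [mu_gs amu]] := code_gs M_monster n_approx Xa.
have dfmu : codes d (pushforward f mu).
  (* 6 = 4 + 2, the second summand being the error of the averages of a. *)
  apply: (@coded_within_codes _ _ _ _ _ 6) => psi k b.
  have [g gP] := thetaP psi; have := close psi k b; rewrite -gP.
  have := (coded_within_codeP _ Xa).1 amu (theta psi) k (g b).
  rewrite /pushforward -gP.
  by rewrite !ler_norml => /andP[? ?] /andP[? ?]; apply/andP; split; lra.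
have [C CE] := class_of_code Xa; have [D DE] := class_of_code Xd.
exists C, D; split.
- exists mu; split; split=> //; [by exists a| |by exists d].
  exact: (pushforward_gs M_monster n_approx f_def mu_gs).
- by rewrite CE; split=> //; exact: code_eqv_refl.
- by rewrite DE; split=> //; exact: code_eqv_refl.
Qed.

End PushforwardGraph.

Theorem proposition3p29 (R : realType) (K : Type) (L : signature)
    (T : set (sentence L)) (M : structure L)
    (T_complete : complete_theory T) (T_NIP : NIP T)
    (M_monster : monster_model K T M)
    (n : forall x : seq (sorts L), xform x -> R -> nat)
    (n_approx : approximation_numbers K M n)
    (x y : seq (sorts L)) (A : set (elem M)) (f : pt M x -> pt M y)
    (f_definable : definable_map A f) :
  type_definable_map K A (@pushforward_graph R K L M n x y f).
Proof.
have [K_lim ss fs rs _ _ _] := M_monster.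
split=> [C|].
  have [D CD] := pushforward_graph_total M_monster n_approx f_definable C.
  by exists D; split=> // D'; exact: (pushforward_graph_unique f_definable CD).
have /choice[theta thetaP] := pullback_xform f_definable.
pose V := sumsort (@code_sort R L n x) (@code_sort R L n y).
have dX z : type_definable K A (@code_set R L M n z).
  exact: type_definable_code_set.
have dXx : type_definable K A [set e : asg M V | code_set (left_part e)].
  by apply: (@type_definable_comp _ _ _ _ _ _ _ _ _
    (fun v => @TVar _ _ V (inl v))) (dX x).
have dXy : type_definable K A [set e : asg M V | code_set (right_part e)].
  by apply: (@type_definable_comp _ _ _ _ _ _ _ _ _
    (fun v => @TVar _ _ V (inr v))) (dX y).
have sI : smallT K (xform y * nat)%type.
  apply: small_prod => //; first exact: small_xform.
  by apply: (@small_countable _ _ _ id).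
have := type_definable_and K_lim (type_definable_and K_lim dXx dXy)
  (type_definable_bigcap sI (fun i =>
     definable_close_averages n i.1 (theta i.1) i.2 f_definable)).
congr type_definable; apply/funext => e; apply/propext.
rewrite /= (pushforward_graph_codes M_monster n_approx f_definable _ _ thetaP).
split=> [[[Xa Xd] close]|[Xa Xd close]].
  by split=> // psi k; exact: close (psi, k).
by split=> // -[psi k]; exact: close.
Qed.
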